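(* Let $X$ be a compact metric space, $f:X\to X$ a continuous map and $\mu$ an $f$-invariant Borel probability measure on $X$. If $\mu$ is ergodic, then for $\hat\mu$-a.e. $\hat x=(x,x_{-1},x_{-2},\ldots)\in\widehat X$, $$\lim_{\varepsilon\to0}\liminf_{n\to\infty}\frac{-\log\mu(B_n(x_{-n},\varepsilon))}{n}=\lim_{\varepsilon\to0}\limsup_{n\to\infty}\frac{-\log\mu(B_n(x_{-n},\varepsilon))}{n}=h_f(\mu),$$ where $h_f(\mu)$ is the entropy of $\mu$ with respect to $f$.
   Context: $B_n(y,\varepsilon)=\{z\in X:d(f^i(y),f^i(z))<\varepsilon,\ 0\le i\le n\}$. Inverse limit: $\widehat X=\{\hat x=(x_0,x_{-1},x_{-2},\ldots): x_{-i}\in X,\ f(x_{-i})=x_{-i+1},\ i\ge1\}$, $x=x_0$, $\pi(\hat x)=x_0$, $\hat f(x_0,x_{-1},\ldots)=(f(x_0),x_0,x_{-1},\ldots)$; $\hat\mu$ is the unique $\hat f$-invariant ergodic probability measure on $\widehat X$ with $\pi_*\hat\mu=\mu$. *)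

(* Defs.v *)
From HB Require Import structures.
From mathcomp Require Import all_boot all_order all_algebra.
From mathcomp Require Import all_classical all_reals all_analysis.

Set Implicit Arguments.
Unset Strict Implicit.
Unset Printing Implicit Defensive.

Import Order.TTheory GRing.Theory Num.Theory.
Import numFieldTopology.Exports.

Local Open Scope classical_set_scope.
Local Open Scope ring_scope.

(** Measurable types are pointed in MathComp-Analysis, so the phase space is a
    pointed metric space; a space carrying a probability measure is nonempty,
    hence this is no restriction. *)
#[short(type="pmetricType")]
HB.structure Definition PointedMetric (K : numDomainType) :=
  { M of Metric K M & isPointed M }.

Notation borel T := (g_sigma_algebraType (@open T)).

Section measure_dynamics.
Context {d : measure_display} {T : measurableType d} {R : realType}.
Implicit Types (mu : probability T R) (f : T -> T).

Definition invariant_measure mu f : Prop :=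
  forall A : set T, measurable A -> mu (f @^-1` A) = mu A.

Definition ergodic_measure mu f : Prop :=
  forall A : set T, measurable A -> f @^-1` A = A ->
    mu A = 0%E \/ mu A = 1%E.

(** Finite measurable partitions, as families indexed by ['I_k]; cells may be
    empty, which does not affect the entropy. *)
Definition measurable_partition (k : nat) (P : 'I_k -> set T) : Prop :=
  [/\ forall i, measurable (P i), trivIset [set: 'I_k] P &
      \bigcup_(i in [set: 'I_k]) P i = [set: T]].

(** The cell, labelled by [w], of the join of [f^-i P] for [0 <= i < n]. *)
Definition join_cell f (k : nat) (P : 'I_k -> set T) (n : nat)
    (w : {ffun 'I_n -> 'I_k}) : set T :=
  \bigcap_(i in [set: 'I_n]) (iter i f @^-1` P (w i)).

(** Cells of measure zero contribute [0 * ln 0 = 0]. *)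
Definition join_entropy mu f (k : nat) (P : 'I_k -> set T) (n : nat) : R :=
  - \sum_(w : {ffun 'I_n -> 'I_k})
      fine (mu (join_cell f P w)) * ln (fine (mu (join_cell f P w))).

Definition partition_entropy mu f (k : nat) (P : 'I_k -> set T) : R :=
  limn (fun n => join_entropy mu f P n / n%:R).

(** The Kolmogorov-Sinai entropy. *)
Definition entropy mu f : \bar R :=
  ereal_sup [set h | exists (k : nat) (P : 'I_k -> set T),
    measurable_partition P /\ h = (partition_entropy mu f P)%:E].

End measure_dynamics.

Definition bowen_ball {R : realType} {X : metricType R} (f : X -> X)
    (n : nat) (y : X) (e : R) : set X :=
  [set z | forall i, (i <= n)%N -> mdist (iter i f y) (iter i f z) < e].

Definition backward_orbits {X : Type} (f : X -> X) :
    set (prod_topology (fun _ : nat => X)) :=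
  [set x | forall i, f (x i.+1) = x i].

Lemma backward_orbits_nonempty {R : realType} {X : pmetricType R} (f : X -> X) :
  compact [set: X] -> continuous f -> backward_orbits f !=set0.
Proof.
move=> cX cf.
pose K : topologicalType := prod_topology (fun _ : nat => X).
pose u (n : nat) : K := fun i => iter (n - i) f point.
have cK : compact [set x : K | forall i, [set: X] (x i)].
  exact: (@tychonoff nat (fun _ => X) (fun _ => setT) (fun _ => cX)).
have [|p [_ clp]] := cK (u @ \oo) _; first by exists 0%N.
exists p => i /=; apply: (@metric_hausdorff _ X) => A B nA nB.
have cB (j : nat) : continuous (fun x : K => x j).
  exact: (@proj_continuous nat (fun _ => X) j).
have cA : continuous (fun x : K => f (x i.+1)).
  by move=> x; apply: (cvg_comp _ _ (cB i.+1 x)); exact: cf.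
have nA' : nbhs p ((fun x : K => f (x i.+1)) @^-1` A) by exact: (cA p).
have nB' : nbhs p ((fun x : K => x i) @^-1` B) by exact: (cB i p).
have evU : (u @ \oo) [set x : K | f (x i.+1) = x i].
  exists i.+1 => // n /= ltin.
  by rewrite /u -iterS subnSK.
have [x [/= fx [Ax Bx]]] := clp _ _ evU (filterI nA' nB').
by exists (x i); split => //; rewrite -fx.
Qed.

(** The inverse limit, with the topology induced by the product topology; the
    coordinate [x i] stands for [x_(-i)]. The two hypotheses only serve to show
    that the type is inhabited. *)
Definition inverse_limit {R : realType} {X : pmetricType R} {f : X -> X}
    (_ : compact [set: X]) (_ : continuous f) : Type :=
  set_type (backward_orbits f).

Section inverse_limit.
Context {R : realType} {X : pmetricType R} {f : X -> X}.
Context (cX : compact [set: X]) (cf : continuous f).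

Local Notation Xhat := (inverse_limit cX cf).

HB.instance Definition _ :=
  Topological.copy Xhat (set_type (backward_orbits f)).

Definition inverse_limit_point : Xhat :=
  exist (fun x => x \in backward_orbits f) _
    (mem_set (svalP (cid (backward_orbits_nonempty cX cf)))).

HB.instance Definition _ := isPointed.Build Xhat inverse_limit_point.

Definition inverse_limit_coord (xh : Xhat) (i : nat) : X := \val xh i.

Definition inverse_limit_proj (xh : Xhat) : X := inverse_limit_coord xh 0.

Let shift_seq (x : nat -> X) (i : nat) : X :=
  if i is j.+1 then x j else f (x 0%N).

Let shift_seqP (xh : Xhat) : backward_orbits f (shift_seq (\val xh)).
Proof. by case=> [//|i] /=; exact: (set_valP xh i). Qed.

Definition inverse_limit_shift (xh : Xhat) : Xhat :=
  exist _ (shift_seq (\val xh)) (mem_set (shift_seqP xh)).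

End inverse_limit.

(* Main.v *)
Require Import Defs.
From HB Require Import structures.
From mathcomp Require Import all_boot all_order all_algebra.
From mathcomp Require Import all_classical all_reals all_analysis.
From mathcomp Require Import measurable_realfun ring lra.

Set Implicit Arguments.
Unset Strict Implicit.
Unset Printing Implicit Defensive.

Import Order.TTheory GRing.Theory Num.Theory.
Import numFieldTopology.Exports.

Local Open Scope classical_set_scope.
Local Open Scope ring_scope.

(** Let [S] be the inverse of the shift of the natural extension, which drops the
    coordinate [x_0], and let [p_n] be the measure of the set of points whose
    first [n] backward coordinates are close to, or carry the same letters as,
    those of the given point. As [p_(n+1) <= p_n o S], ergodicity shows that, up
    to an arbitrarily small change of [r], the event [p_n > exp (- r n)
    infinitely often] has measure 0 or 1. If it has measure 1, almost every orbit
    can be parsed greedily into blocks on which [p_n > exp (- r n)], with few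
    exceptional times. Averaging over all parsings gives a subprobability on
    words that assigns to a typical word of length [N] about [exp (- r N)].
    Gibbs' inequality then bounds the entropy of [N]-words by about [r N]. Hence
    [r] is at least the entropy of the partition, which is the lower bound for
    Bowen balls; applied to cylinders the same argument shows that the
    normalized entropies converge. For the upper bound, Markov's inequality
    gives cylinders with [p_n > exp (- r n)] infinitely often for every [r]
    above the entropy, the maximal inequality controls the exceptional times
    almost surely, and Borel-Cantelli compares the measures of the cylinders
    with the subprobability. Neither Birkhoff's theorem nor the
    Shannon-McMillan-Breiman theorem is used. *)

(** * Weights on words *)

Section words.
Context {R : realType} (k : nat).
Implicit Types (F G : seq 'I_k -> R) (w : seq 'I_k).

Fixpoint words (n : nat) : seq (seq 'I_k) :=
  if n is n'.+1 then [seq a :: w | a <- enum 'I_k, w <- words n'] else [:: [::]].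

Lemma mem_words n w : (w \in words n) = (size w == n).
Proof.
elim: n w => [|n IH] [|a w] //=.
  by apply/negP => /allpairsP[[b v] /= [_ _]].
rewrite eqSS -IH; apply/allpairsP/idP => [[[b v] /= [_ vn [_ ->]]]//|wn].
by exists (a, w); rewrite mem_enum.
Qed.

Lemma uniq_words n : uniq (words n).
Proof.
elim: n => //= n IH; apply: allpairs_uniq => //; first exact: enum_uniq.
by move=> [a v] [b w] _ _ [-> ->].
Qed.

Lemma sum_words_cons n F :
  \sum_(w <- words n.+1) F w = \sum_(a < k) \sum_(w <- words n) F (a :: w).
Proof. by rewrite [words _]/= big_allpairs_dep big_enum. Qed.

Lemma sum_words0 F : \sum_(w <- words 0) F w = F [::].
Proof. by rewrite big_seq1. Qed.

Lemma sum_words_cat m n F G :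
  \sum_(w <- words (m + n)) F (take m w) * G (drop m w) =
  (\sum_(w <- words m) F w) * \sum_(w <- words n) G w.
Proof.
elim: m F => [|m IH] F; rewrite ?add0n ?addSn.
  by rewrite sum_words0 mulr_sumr; apply: eq_bigr => w _; rewrite take0 drop0.
rewrite !sum_words_cons mulr_suml; apply: eq_bigr => a _ /=.
by rewrite -(IH (fun w => F (a :: w))).
Qed.

(** Probability that a memoryless channel turns [b] into [a]: with weight [x] the letter is kept,
    with weight [1 - x] it is redrawn uniformly. [word_noise] is the product over positions, meant
    for words of equal length. *)
Definition letter_noise (x : R) (a b : 'I_k) : R :=
  x * (a == b)%:R + (1 - x) / k%:R.

Fixpoint word_noise (x : R) (w v : seq 'I_k) : R :=
  match w, v with
  | a :: w', b :: v' => letter_noise x a b * word_noise x w' v'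
  | _, _ => 1
  end.

Lemma letter_noise_ge0 x a b : 0 <= x <= 1 -> 0 <= letter_noise x a b.
Proof.
move=> /andP[x0 x1]; apply: addr_ge0; first exact: mulr_ge0.
by rewrite divr_ge0// subr_ge0.
Qed.

Lemma word_noise_ge0 x w v : 0 <= x <= 1 -> 0 <= word_noise x w v.
Proof.
move=> x01; elim: w v => [|a w IH] [|b v]//=.
by rewrite mulr_ge0 ?letter_noise_ge0.
Qed.

Lemma sum_letter_noise x b : \sum_(a < k) letter_noise x a b = 1.
Proof.
rewrite big_split/= -mulr_sumr (bigD1 b)//= eqxx big1 ?addr0; last first.
  by move=> a /negbTE ->.
rewrite mulr1 sumr_const card_ord -[(1 - x) / _ *+ _]mulr_natr divfK ?subrKC//.
by rewrite pnatr_eq0 -lt0n (leq_trans _ (ltn_ord b)).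
Qed.

Lemma sum_word_noise x v n : size v = n ->
  \sum_(w <- words n) word_noise x w v = 1.
Proof.
elim: n v => [|n IH] [|b v]//=; first by rewrite sum_words0.
move=> [vn]; rewrite sum_words_cons/= -[RHS](sum_letter_noise x b).
by apply: eq_bigr => a _; rewrite -mulr_sumr IH// mulr1.
Qed.

(** The weight of [w] sums over all parsings of [w] into single letters, chosen
    uniformly, and blocks of length at least [m]; a block of length [j] is
    chosen according to [theta] at the cost of a factor [x ^+ j]. The value is
    meaningful only if [size w <= fuel]. *)
Fixpoint parse_weight (x : R) (m : nat) (theta : seq 'I_k -> R) (fuel : nat) w :
    R :=
  if fuel is fuel'.+1 then
    if w is b :: w' then
      (k%:R *+ 2)^-1 * parse_weight x m theta fuel' w' +
      \sum_(j < size w | (m <= j.+1)%N) x ^+ j.+1 *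
        (theta (take j.+1 w) * parse_weight x m theta fuel' (drop j.+1 w))
    else 1
  else 1.

Section parse_weight.
Variables (x : R) (m : nat) (theta : seq 'I_k -> R).
Hypotheses (x01 : 0 <= x <= 1) (theta_ge0 : forall w, 0 <= theta w)
  (theta_le1 : forall n, \sum_(w <- words n) theta w <= 1)
  (xm : forall n, \sum_(j < n | (m <= j.+1)%N) x ^+ j.+1 <= 2^-1).
Local Notation nu := (parse_weight x m theta).

Lemma parse_weight_ge0 fuel w : 0 <= nu fuel w.
Proof.
have /andP[x0 _] := x01.
elim: fuel w => //= f IH [|b w]//; apply: addr_ge0.
  by rewrite mulr_ge0// invr_ge0 mulrn_wge0.
by apply: sumr_ge0 => j _; rewrite !mulr_ge0 ?exprn_ge0.
Qed.

(** Induction on the fuel. The choice of a single first letter contributes at most [1 / 2] in total;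
    a first block of length [j] contributes at most [x ^+ j], and the admissible lengths sum to at
    most [1 / 2] by [xm]. *)
Lemma sum_parse_weight fuel n : (n <= fuel)%N ->
  \sum_(w <- words n) nu fuel w <= 1.
Proof.
have /andP[x0 _] := x01.
elim: fuel n => [|f IH] [|n] nf //; rewrite ?sum_words0//.
have [k0|k0] := posnP k.
  rewrite sum_words_cons big1 ?ler01// => -[i ik] _.
  by have : (i < 0)%N by rewrite -k0.
rewrite sum_words_cons/=.
under eq_bigr do rewrite big_split/=.
rewrite big_split/= [leRHS](_ : 1 = 2^-1 + 2^-1); last by field.
apply: lerD.
  have e : (k%:R *+ 2)^-1 *+ k = 2^-1 :> R.
    have : k%:R != 0 :> R by rewrite pnatr_eq0 -lt0n.
    by rewrite -[LHS]mulr_natr -[k%:R *+ 2]mulr_natr => ?; field.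
  by rewrite sumr_const card_ord -mulr_sumr -mulrnAl e ler_piMr ?IH.
rewrite -(sum_words_cons n (fun w => \sum_(j < size w | (m <= j.+1)%N)
  x ^+ j.+1 * (theta (take j.+1 w) * nu f (drop j.+1 w)))).
rewrite big_seq.
under eq_bigr => w.
  rewrite mem_words => /eqP ->; over.
rewrite -big_seq exchange_big/= (le_trans _ (xm n.+1))//; apply: ler_sum => j mj.
rewrite -mulr_sumr ler_piMr ?exprn_ge0//.
have := sum_words_cat j.+1 (n.+1 - j.+1) theta (nu f).
rewrite subnKC// => ->; rewrite mulr_ile1 ?sumr_ge0 ?IH// => [w _|].
  exact: parse_weight_ge0.
by rewrite subSS (leq_trans (leq_subr _ _)).
Qed.

(** The parsing into single letters alone contributes this much. This makes the weight positive and
    pays for the letters left over when a block does not fit. *)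
Lemma parse_weight_ge fuel w : (0 < k)%N -> (k%:R *+ 2)^-1 ^+ size w <= nu fuel w.
Proof.
have /andP[x0 _] := x01 => k0.
have h0 : 0 <= (k%:R *+ 2 : R)^-1 by rewrite invr_ge0 mulrn_wge0.
have h1 : (k%:R *+ 2 : R)^-1 <= 1.
  by rewrite invf_le1 -?natrM ?mulr_natl -?mulrnA ?ler1n ?ltr0n muln_gt0 ?k0.
elim: fuel w => [|f IH] [|b w]//=; first by rewrite exprn_ile1.
rewrite exprS -[leLHS]addr0 lerD ?ler_wpM2l ?IH// sumr_ge0// => j _.
by rewrite !mulr_ge0 ?exprn_ge0 ?parse_weight_ge0.
Qed.

Lemma parse_weight_cons fuel b w :
  (k%:R *+ 2)^-1 * nu fuel w <= nu fuel.+1 (b :: w).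
Proof.
have /andP[x0 _] := x01.
rewrite /= lerDl sumr_ge0// => j _.
by rewrite !mulr_ge0 ?exprn_ge0 ?parse_weight_ge0.
Qed.

Lemma parse_weight_block fuel w j : (m <= j)%N -> (0 < j <= size w)%N ->
  x ^+ j * (theta (take j w) * nu fuel (drop j w)) <= nu fuel.+1 w.
Proof.
have /andP[x0 _] := x01.
case: w => [|b w] mj; first by case: j mj.
case: j mj => // j mj /= jw.
rewrite (bigD1 (Ordinal jw))//= addrA addrC addrA lerDr addr_ge0//.
  apply: sumr_ge0 => i _.
  by rewrite !mulr_ge0 ?exprn_ge0 ?parse_weight_ge0.
by rewrite mulr_ge0 ?parse_weight_ge0// invr_ge0 mulrn_wge0.
Qed.

End parse_weight.
End words.

(** Provides the minimal block length for [parse_weight]; the strict [m < j.+1] means that [m.+1],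
    which is positive, is used there. *)
Lemma geometric_tail {R : realType} (x : R) : 0 <= x < 1 ->
  exists m, forall n, \sum_(j < n | (m < j.+1)%N) x ^+ j.+1 <= 2^-1.
Proof.
move=> /andP[x0 x1].
have [m hm] : exists m, x ^+ m / (1 - x) <= 2^-1.
  have : (fun m => x ^+ m) @ \oo --> (0 : R).
    by apply: cvg_expr; rewrite ger0_norm.
  move=> /cvgrPdist_le/(_ (2^-1 * (1 - x))) [|m _ /(_ m (leqnn m))].
    by rewrite mulr_gt0 ?subr_gt0.
  rewrite sub0r normrN ger0_norm ?exprn_ge0// => h.
  by exists m; rewrite ler_pdivrMr ?subr_gt0.
exists m => n; apply: le_trans hm.
apply: (@le_trans _ _ (\sum_(j < n | (m <= j.+1)%N) x ^+ j.+1)).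
  rewrite [leRHS]big_mkcond [leLHS]big_mkcond/=.
  apply: ler_sum => j _; case: ifPn => [/ltnW ->//|_].
  by case: ifPn => // _; rewrite exprn_ge0.
rewrite ler_pdivlMr ?subr_gt0//.
(* The sum telescopes; [maxn] covers the range [n < m], where it is empty. *)
have h : \sum_(j < n | (m <= j.+1)%N) x ^+ j.+1 * (1 - x) <=
  x ^+ m - x ^+ (maxn m n.+1).
  elim: n => [|n IH].
    rewrite big_ord0 subr_ge0 ler_wiXn2l// ?ltW//; exact: leq_maxl.
  rewrite big_mkcond big_ord_recr/= -big_mkcond/=.
  case: ifPn => mn.
    rewrite (maxn_idPr mn) in IH.
    rewrite (maxn_idPr (leqW mn)) (le_trans (lerD IH (lexx _)))// mulrBr mulr1 -exprSr; lra.
  by rewrite -ltnNge in mn; rewrite addr0 (le_trans IH)// lerD2l lerN2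
    (maxn_idPl (ltnW mn)) (maxn_idPl mn).
rewrite mulr_suml (le_trans h)// gerBl exprn_ge0//.
Qed.

(** * Probabilities of finite combinations of events *)

Section probability_of.
Context {d : measure_display} {T : measurableType d} {R : realType}.
Variable mu : probability T R.

Definition pr (A : set T) : R := fine (mu A).

Lemma prE A : measurable A -> (pr A)%:E = mu A.
Proof. by move=> mA; rewrite fineK// fin_num_measure. Qed.

Lemma pr_ge0 A : 0 <= pr A.
Proof. exact: fine_ge0. Qed.

Lemma le_pr A B : measurable A -> measurable B -> A `<=` B -> pr A <= pr B.
Proof.
by move=> mA mB AB; rewrite -lee_fin !prE// le_measure ?inE.
Qed.

Lemma prT : pr [set: T] = 1.
Proof. by rewrite /pr probability_setT. Qed.

Lemma pr_le1 A : measurable A -> pr A <= 1.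
Proof. by move=> mA; rewrite -prT le_pr. Qed.

Lemma prC A : measurable A -> pr (~` A) = 1 - pr A.
Proof.
move=> mA; apply: EFin_inj; rewrite EFinB !prE ?probability_setC//.
exact: measurableC.
Qed.

Lemma prU0 A B : measurable A -> measurable B -> mu B = 0%E ->
  pr (B `|` A) = pr A.
Proof. by move=> mA mB B0; rewrite /pr setUC measureU0. Qed.

Lemma prU A B : measurable A -> measurable B -> pr (A `|` B) <= pr A + pr B.
Proof.
move=> mA mB; rewrite -lee_fin EFinD !prE//; last exact: measurableU.
by apply: measureU2.
Qed.

Lemma integral_sum_indic (I : Type) (s : seq I) (c : I -> R) (A : I -> set T) :
  (forall i, measurable (A i)) -> (forall i, 0 <= c i) ->
  (\int[mu]_w (\sum_(i <- s) c i * \1_(A i) w)%:E)%E =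
  (\sum_(i <- s) c i * pr (A i))%:E.
Proof.
move=> mA c0.
under eq_integral do rewrite -sumEFin.
rewrite ge0_integral_sum//; last 2 first.
- move=> i; apply/measurable_EFinP/measurable_funM => //.
- by move=> i w _; rewrite lee_fin mulr_ge0.
rewrite -sumEFin; apply: eq_bigr => i _.
under eq_integral do rewrite EFinM.
rewrite ge0_integralZl_EFin//; last exact/measurable_EFinP.
by rewrite integral_indic// setIT EFinM prE.
Qed.

(** Integrates a pointwise inequality between two simple functions; the averaging arguments below
    pass through it. *)
Lemma sum_pr_le (I J : Type) (s : seq I) (t : seq J) (c : I -> R) (e : J -> R)
    (A : I -> set T) (B : J -> set T) :
  (forall i, measurable (A i)) -> (forall j, measurable (B j)) ->
  (forall i, 0 <= c i) -> (forall j, 0 <= e j) ->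
  (forall w, \sum_(i <- s) c i * \1_(A i) w <= \sum_(j <- t) e j * \1_(B j) w) ->
  \sum_(i <- s) c i * pr (A i) <= \sum_(j <- t) e j * pr (B j).
Proof.
move=> mA mB c0 e0 le; rewrite -lee_fin -!integral_sum_indic//.
have mf (K : Type) (u : seq K) (g : K -> R) (C : K -> set T) :
    (forall k, measurable (C k)) ->
    measurable_fun setT (fun w => (\sum_(k <- u) g k * \1_(C k) w)%:E).
  move=> mC; apply/measurable_EFinP/measurable_sum => k.
  exact: measurable_funM.
apply: ge0_le_integral => //; try exact: mf; try by move=> w _; rewrite lee_fin.
by move=> w _; rewrite lee_fin sumr_ge0// => i _; rewrite mulr_ge0.
Qed.

Lemma pr_nonincreasing_lt (F : nat -> set T) (eta : R) :
  (forall n, measurable (F n)) ->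
  (forall n m, (n <= m)%N -> F m `<=` F n) -> pr (\bigcap_n F n) < eta ->
  exists n, pr (F n) < eta.
Proof.
move=> mF ndF h.
have mI : measurable (\bigcap_n F n) by exact: bigcapT_measurable.
have F0 : (mu (F 0%N) < +oo)%E by rewrite -prE// ltry.
have ndF' : {homo F : n m / (n <= m)%N >-> (m <= n)%O}.
  by move=> n m nm; apply/subsetPset; exact: ndF.
have : mu (F n) @[n --> \oo] --> mu (\bigcap_n F n).
  exact: nonincreasing_cvg_mu F0 mF mI ndF'.
rewrite -(prE mI) => /fine_cvgP[_ /cvgr_lt/(_ _ h)[n _ /(_ n (leqnn n)) hn]].
by exists n.
Qed.

Lemma pr_nondecreasing_eq (F : nat -> set T) (c : R) :
  (forall n, measurable (F n)) ->
  (forall n m, (n <= m)%N -> F n `<=` F m) -> (forall n, pr (F n) = c) ->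
  pr (\bigcup_n F n) = c.
Proof.
move=> mF ndF h.
have mI : measurable (\bigcup_n F n) by exact: bigcupT_measurable.
have ndF' : {homo F : n m / (n <= m)%N >-> (n <= m)%O}.
  by move=> n m nm; apply/subsetPset; exact: ndF.
have : mu (F n) @[n --> \oo] --> mu (\bigcup_n F n).
  exact: nondecreasing_cvg_mu mF mI ndF'.
rewrite -(prE mI) => /fine_cvgP[_ /(cvg_lim (@Rhausdorff R)) <-].
have -> : fine \o (fun n => mu (F n)) = cst c by apply/funext => n; exact: h.
by rewrite lim_cst//; exact: Rhausdorff.
Qed.

(** Fatou's lemma for events: the tail unions decrease to the limit superior, and each has measure
    at least [c]. *)
Lemma pr_limsup_ge (c : R) (F : nat -> set T) :
  (forall n, measurable (F n)) ->
  (forall n, exists2 m, (n <= m)%N & c <= pr (F m)) ->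
  c <= pr (\bigcap_n \bigcup_(m in [set m | (n <= m)%N]) F m).
Proof.
move=> mF h; rewrite leNgt; apply/negP => lt.
have mU n : measurable (\bigcup_(m in [set m | (n <= m)%N]) F m).
  exact: bigcup_measurable.
have [|n] := pr_nonincreasing_lt mU _ lt.
  by move=> n m nm w [i /= mi Fi]; exists i => //=; exact: leq_trans mi.
apply/negP; rewrite -leNgt; have [m nm cm] := h n.
by rewrite (le_trans cm)// le_pr// => w Fw; exists m.
Qed.

Lemma ae_pr1 (A : set T) : measurable A -> pr A = 1 -> {ae mu, forall w, A w}.
Proof.
move=> mA A1; exists (~` A); split => //; first exact: measurableC.
by rewrite -prE ?prC ?A1 ?subrr//; exact: measurableC.
Qed.

End probability_of.

(** * Measure-preserving maps and the maximal inequality *)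

Section orbit_sum.
Context {T : Type} (S : T -> T).
Implicit Types c : T -> nat.

Definition orbit_sum c n w := \sum_(i < n) c (iter i S w).

Lemma orbit_sumS c n w : orbit_sum c n.+1 w = (c w + orbit_sum c n (S w))%N.
Proof.
rewrite /orbit_sum big_ord_recl/=; congr addn.
by apply: eq_bigr => i _; rewrite -iterSr.
Qed.

Lemma orbit_sum_add c m n w :
  orbit_sum c (m + n) w = (orbit_sum c m w + orbit_sum c n (iter m S w))%N.
Proof.
elim: m w => [|m IH] w; first by rewrite /orbit_sum big_ord0.
by rewrite addSn !orbit_sumS IH addnA -iterSr.
Qed.

Lemma leq_orbit_sum c m n w : (m <= n)%N -> (orbit_sum c m w <= orbit_sum c n w)%N.
Proof. by move=> mn; rewrite -(subnKC mn) orbit_sum_add leq_addr. Qed.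

(** The combinatorial core of the maximal ergodic inequality: cover the orbit
    greedily by blocks on which the average of [c] is at least [t]. *)
Lemma orbit_sum_maximal {R : realType} c (e : T -> bool) (t : R) (L N : nat) w :
  0 <= t -> (forall v, e v -> exists2 n, (0 < n <= L)%N &
    t * n%:R <= (orbit_sum c n v)%:R) ->
  t * (orbit_sum e N w)%:R <= (orbit_sum c (N + L) w)%:R.
Proof.
move=> t0 he.
elim: N {-2}N (leqnn N) w => [|M IH] N NM w.
  move: NM; rewrite leqn0 => /eqP ->.
  by rewrite {1}/orbit_sum big_ord0 mulr0.
case: N NM => [|N] NM; first by rewrite {1}/orbit_sum big_ord0 mulr0.
have [ew|new] := boolP (e w); last first.
  rewrite orbit_sumS (negbTE new) add0n addSn orbit_sumS.
  by rewrite (le_trans (IH N NM _))// ler_nat leq_addl.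
have [n /andP[n0 nL] hn] := he _ ew.
have eN j v : (orbit_sum e j v <= j)%N.
  rewrite /orbit_sum -[leqRHS]card_ord -sum1_card leq_sum// => i _.
  by case: (e _).
(* If the block reaches or passes time [N.+1], at most [n] visits remain to be counted, and the
   whole block lies within the extended horizon because [n <= L]. *)
have [Nn|nN] := leqP N.+1 n.
  rewrite (le_trans (y := t * n%:R))//.
    by rewrite ler_wpM2l// ler_nat (leq_trans (eN _ _)).
  by rewrite (le_trans hn)// ler_nat leq_orbit_sum// (leq_trans nL)// leq_addl.
rewrite -(subnKC (ltnW nN)) -addnA !orbit_sum_add !natrD mulrDr lerD//.
  by rewrite (le_trans _ hn)// ler_wpM2l// ler_nat.
rewrite -natrD -orbit_sum_add; apply: IH; rewrite -ltnS (leq_trans _ NM)// ltnS.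
by case: n n0 nN {hn nL} => // n _ nN; rewrite subSS leq_subr.
Qed.

End orbit_sum.

Section dynamics.
Context {d : measure_display} {T : measurableType d} {R : realType}.
Variables (mu : probability T R) (S : T -> T).
Hypotheses (mS : measurable_fun [set: T] S) (muS : invariant_measure mu S).
Local Notation pr := (pr mu).

Lemma measurable_preimage A : measurable A -> measurable (S @^-1` A).
Proof. by move=> mA; rewrite -[_ @^-1` _]setTI; exact: mS. Qed.

Lemma measurable_iter_preimage n A :
  measurable A -> measurable (iter n S @^-1` A).
Proof.
move=> mA; elim: n => //= n IH.
by rewrite (_ : _ @^-1` _ = S @^-1` (iter n S @^-1` A));
  [exact: measurable_preimage|apply/seteqP; split => w /=; rewrite -iterSr].
Qed.

Lemma pr_preimage A : measurable A -> pr (S @^-1` A) = pr A.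
Proof. by move=> mA; rewrite /pr muS. Qed.

Lemma pr_iter_preimage n A : measurable A -> pr (iter n S @^-1` A) = pr A.
Proof.
move=> mA; elim: n => //= n IH.
rewrite (_ : _ @^-1` _ = S @^-1` (iter n S @^-1` A)).
  by rewrite pr_preimage//; exact: measurable_iter_preimage.
by apply/seteqP; split => w /=; rewrite -iterSr.
Qed.

(** [ergodic_measure] speaks of strictly invariant sets. The preimages of [A] under the iterates
    increase and all have the measure of [A]; their union is strictly invariant. *)
Lemma pr_subinvariant A : ergodic_measure mu S -> measurable A ->
  A `<=` S @^-1` A -> 0 < pr A -> pr A = 1.
Proof.
move=> erg mA AS A0.
pose F n := iter n S @^-1` A.
have mF n : measurable (F n) by exact: measurable_iter_preimage.
have ndF n m : (n <= m)%N -> F n `<=` F m.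
  move=> nm; rewrite -(subnK nm) => w; rewrite /F/= iterD.
  by elim: (m - n)%N => //= i IH /IH; exact: AS.
have prF : pr (\bigcup_n F n) = pr A.
  by apply: pr_nondecreasing_eq => // n; exact: pr_iter_preimage.
have SF : S @^-1` (\bigcup_n F n) = \bigcup_n F n.
  apply/seteqP; split => w [n _] /=; rewrite /F/=.
    by move=> Aw; exists n.+1 => //=; rewrite /F/= -iterS iterSr.
  by move=> Aw; exists n => //=; rewrite /F/= -iterSr/=; exact: AS.
have [] := erg _ (bigcupT_measurable _ mF) SF => h.
  by move: A0; rewrite -prF /pr h ltxx.
by rewrite -prF /pr h.
Qed.

Lemma sum_pr_iter (A : set T) n : measurable A ->
  \sum_(i < n) pr (iter i S @^-1` A) = n%:R * pr A.
Proof.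
move=> mA; under eq_bigr do rewrite pr_iter_preimage//.
by rewrite sumr_const card_ord mulr_natl.
Qed.

Lemma orbit_sum_mem (A : set T) n w :
  (orbit_sum S (fun v => v \in A) n w)%:R =
  \sum_(i < n) \1_(iter i S @^-1` A) w :> R.
Proof. by rewrite natr_sum; apply: eq_bigr => i _; rewrite indicE. Qed.

Lemma measurable_orbit_sum_ge (A : set T) (t : R) n : measurable A ->
  measurable [set w | t <= (orbit_sum S (fun v => v \in A) n w)%:R].
Proof.
move=> mA; pose f w : R := (orbit_sum S (fun v => v \in A) n w)%:R.
rewrite -[X in measurable X]setTI.
rewrite (_ : [set _ | _] = f @^-1` `[t, +oo[%classic); last first.
  by apply/seteqP; split => w /=; rewrite in_itv/= andbT.
have -> : f = fun w => \sum_(i < n) \1_(iter i S @^-1` A) w.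
  by apply/funext => w; rewrite /f orbit_sum_mem.
have : measurable_fun setT (fun w => \sum_(i < n) \1_(iter i S @^-1` A) w : R).
  apply: measurable_sum => i.
  by apply: measurable_indic; exact: measurable_iter_preimage.
exact.
Qed.

Definition large_average (A : set T) (t : R) : set T :=
  [set w | exists2 n, (0 < n)%N &
    t * n%:R <= (orbit_sum S (fun v => v \in A) n w)%:R].

Lemma measurable_large_average A t : measurable A ->
  measurable (large_average A t).
Proof.
move=> mA.
rewrite (_ : large_average A t = \bigcup_(n in [set n | (0 < n)%N])
  [set w | t * n%:R <= (orbit_sum S (fun v => v \in A) n w)%:R]).
  by apply: bigcup_measurable => n _; exact: measurable_orbit_sum_ge.
by apply/seteqP; split => w [n]; exists n.
Qed.

(** For block lengths up to [L], [orbit_sum_maximal] is integrated, and a large [N] makes the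
    boundary term negligible; continuity from below then lifts the restriction to [L]. *)
Lemma pr_maximal (A : set T) (t : R) : measurable A -> 0 < t ->
  pr (large_average A t) <= pr A / t.
Proof.
move=> mA t0; rewrite /large_average.
pose f n w : R := (orbit_sum S (fun v => v \in A) n w)%:R.
pose E L := [set w | exists2 n, (0 < n <= L)%N & t * n%:R <= f n w].
have mEn n : measurable [set w | t * n%:R <= f n w].
  exact: measurable_orbit_sum_ge.
have mE L : measurable (E L).
  rewrite (_ : E L = \bigcup_(n in [set n | (0 < n <= L)%N])
    [set w | t * n%:R <= f n w]); first exact: bigcup_measurable.
  by apply/seteqP; split => w [n ? ?]; exists n.
have EL L : t * pr (E L) <= pr A.
  have main N : t * (N%:R * pr (E L)) <= (N + L)%:R * pr A.
    rewrite -!sum_pr_iter// mulr_sumr -[leRHS]mul1r mulr_sumr.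
    apply: sum_pr_le => //; try by move=> ?; exact: measurable_iter_preimage.
    - by move=> _; exact: ltW.
    - move=> w; rewrite -!mulr_sumr -!orbit_sum_mem mul1r.
      apply: orbit_sum_maximal; first exact: ltW.
      by move=> v; rewrite inE.
  rewrite leNgt; apply/negP => lt.
  pose D := t * pr (E L) - pr A.
  have D0 : 0 < D by rewrite subr_gt0.
  (* [N] is so large that [N * D] exceeds the boundary term [L * pr A], contradicting [main]. *)
  have := main (Num.truncn (L%:R * pr A / D)).+1.
  set N := _.+1; have hN : L%:R * pr A < N%:R * D.
    by rewrite -ltr_pdivrMr// truncnS_gt.
  rewrite leNgt => /negP; apply.
  by rewrite natrD mulrDl mulrCA -ltrBDl -mulrBr.
rewrite ler_pdivlMr// mulrC leNgt; apply/negP => lt.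
have mU : measurable (\bigcup_L E L) by exact: bigcupT_measurable.
rewrite (_ : [set _ | _] = \bigcup_L E L) in lt; last first.
  apply/seteqP; split => w.
    by move=> [n n0 hn]; exists n => //; exists n => //; rewrite n0/=.
  by move=> [L _ [n /andP[n0 _] hn]]; exists n.
have : mu (E n) @[n --> \oo] --> mu (\bigcup_n E n).
  apply: nondecreasing_cvg_mu => // n m nm; apply/subsetPset => w [i].
  by move=> /andP[i0 ilen] hi; exists i => //; rewrite i0 (leq_trans ilen).
rewrite -(prE mu mU) => /fine_cvgP[_ /cvgr_gt/(_ (pr A / t))].
rewrite ltr_pdivrMr// mulrC => /(_ lt)[n _ /(_ n (leqnn n))] /=.
by rewrite ltr_pdivrMr// mulrC ltNge EL.
Qed.

End dynamics.

(** * Itineraries and their entropy *)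

Section itinerary.
Context {T : Type} (S : T -> T) (k : nat).
Implicit Type a : T -> 'I_k.

Fixpoint itinerary a n w : seq 'I_k :=
  if n is n'.+1 then a w :: itinerary a n' (S w) else [::].

Definition cylinder a (v : seq 'I_k) : set T :=
  [set w | itinerary a (size v) w = v].

Lemma size_itinerary a n w : size (itinerary a n w) = n.
Proof. by elim: n w => //= n IH w; rewrite IH. Qed.

Lemma itinerary_words a n w : itinerary a n w \in words k n.
Proof. by rewrite mem_words size_itinerary. Qed.

Lemma take_itinerary a m n w : (m <= n)%N ->
  take m (itinerary a n w) = itinerary a m w.
Proof.
by elim: n m w => [|n IH] [|m] w //=; rewrite ltnS => mn; rewrite IH.
Qed.

Lemma drop_itinerary a m n w :
  drop m (itinerary a n w) = itinerary a (n - m) (iter m S w).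
Proof.
elim: n m w => [|n IH] [|m] w //=; rewrite subSS IH -?iterSr//.
Qed.

Lemma cylinder_cons a i v : cylinder a (i :: v) =
  (a @^-1` [set i]) `&` S @^-1` (cylinder a v).
Proof. by apply/seteqP; split => w; rewrite /cylinder/= => -[-> ->]. Qed.

(** Exactly one cylinder of length [n] contains [w]. A function of the itinerary thus becomes a
    simple function, ready for [sum_pr_le]. *)
Lemma sum_cylinder {R : realType} a n w (F : seq 'I_k -> R) :
  \sum_(v <- words k n) F v * \1_(cylinder a v) w = F (itinerary a n w).
Proof.
rewrite (bigD1_seq (itinerary a n w)) ?itinerary_words ?uniq_words//=.
rewrite indicE mem_set ?mulr1; last by rewrite /cylinder/= size_itinerary.
rewrite big1_seq ?addr0// => v /andP[vw]; rewrite mem_words => /eqP vn.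
rewrite indicE memNset ?mulr0// /cylinder/= vn => h.
by move: vw; rewrite h eqxx.
Qed.

(** Common form of cylinders (relation [same_letter]) and of Bowen balls (relation [coord_close]),
    so that one growth argument serves both. *)
Definition ball_along (rel : T -> T -> Prop) n (w : T) : set T :=
  [set v | forall i, (i < n)%N -> rel (iter i S w) (iter i S v)].

Lemma ball_alongS rel n w :
  ball_along rel n.+1 w `<=` S @^-1` (ball_along rel n (S w)).
Proof. by move=> v h i ilen /=; rewrite -!iterSr; exact: h. Qed.

(** While the orbit of [w] is off [U] the letters agree and the channel gives at least [x]; a visit
    to [U] leaves at least the redrawing probability [(1 - x) / k]. *)
Lemma word_noise_along {R : realType} (x : R) rel a b (U : set T) n w v :
  0 <= x <= 1 ->
  (forall w v, ~ U w -> rel w v -> b v = a w) ->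
  ball_along rel n w v ->
  x ^+ n * ((1 - x) / k%:R) ^+ orbit_sum S (fun w => w \in U) n w <=
  word_noise x (itinerary a n w) (itinerary b n v).
Proof.
move=> x01 hU; have /andP[x0 x1] := x01.
have y0 : 0 <= (1 - x) / k%:R by rewrite divr_ge0// subr_ge0.
elim: n w v => [|n IH] w v hB /=; first by rewrite /orbit_sum big_ord0 mulr1.
rewrite orbit_sumS exprS exprD mulrACA; apply: ler_pM.
- by rewrite mulr_ge0// exprn_ge0.
- by rewrite mulr_ge0// exprn_ge0.
- rewrite /letter_noise; have [Uw|nUw] := boolP (w \in U).
    rewrite expr1 -[leLHS]add0r lerD//; last by rewrite ler_piMl.
    by rewrite mulr_ge0.
  rewrite expr0 mulr1 (hU _ _ _ (hB 0%N _)) ?eqxx ?mulr1 ?lerDl//.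
  by move: nUw; rewrite notin_setE.
- by apply: IH; exact: ball_alongS.
Qed.

End itinerary.

(** * Entropy of words and Gibbs' inequality *)

Section entropy_rate.
Context {d : measure_display} {T : measurableType d} {R : realType}.
Variables (mu : probability T R) (S : T -> T) (k : nat).
Hypotheses (mS : measurable_fun [set: T] S) (muS : invariant_measure mu S).
Local Notation pr := (pr mu).

Definition measurable_letter (a : T -> 'I_k) :=
  forall i, measurable (a @^-1` [set i]).

Lemma measurable_cylinder a v : measurable_letter a -> measurable (cylinder S a v).
Proof.
move=> ma; elim: v => [|i v IH].
  by rewrite (_ : cylinder _ _ _ = setT)//; apply/seteqP; split.
by rewrite cylinder_cons; apply: measurableI => //; exact: measurable_preimage.
Qed.

Lemma sum_pr_cylinder a n : measurable_letter a ->
  \sum_(v <- words k n) pr (cylinder S a v) = 1.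
Proof.
move=> ma; have h w : \sum_(v <- words k n) 1 * \1_(cylinder S a v) w = 1 :> R.
  exact: (sum_cylinder S a n w (fun=> 1)).
have mc v : measurable (cylinder S a v) by exact: measurable_cylinder.
under eq_bigr do rewrite -[pr _]mul1r.
apply/eqP; rewrite eq_le; apply/andP; split.
  have := @sum_pr_le _ _ _ mu _ _ (words k n) [:: tt] (fun=> 1) (fun=> 1)
    (cylinder S a) (fun=> setT).
  rewrite !big_seq1 prT mulr1; apply => // w.
  by rewrite h big_seq1 indicT mulr1.
have := @sum_pr_le _ _ _ mu _ _ [:: tt] (words k n) (fun=> 1) (fun=> 1)
  (fun=> setT) (cylinder S a).
rewrite !big_seq1 prT mulr1; apply => // w.
by rewrite h big_seq1 indicT mulr1.
Qed.

Definition word_entropy (a : T -> 'I_k) n : R :=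
  - \sum_(v <- words k n) pr (cylinder S a v) * ln (pr (cylinder S a v)).

(** The inequality [1 + y <= exp y] at [y = ln (q / p)]: the pointwise form of Gibbs' inequality. *)
Lemma mul_ln_le (p q : R) : 0 <= p -> 0 < q -> p * ln q - p * ln p <= q - p.
Proof.
move=> p0 q0; have [->|pn0] := eqVneq p 0; first by rewrite !mul0r !subr0 ltW.
have pp : 0 < p by rewrite lt_def pn0.
rewrite -mulrBr -ln_div ?posrE//.
have := expR_ge1Dx (ln (q / p)); rewrite lnK ?posrE ?divr_gt0// => h.
have := ler_wpM2l p0 h; rewrite mulrDr mulr1 mulrCA divff// mulr1.
by rewrite -lerBrDl.
Qed.

(** Gibbs' inequality, for a subprobability [q]. *)
Lemma word_entropy_le a n (q : seq 'I_k -> R) : measurable_letter a ->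
  (forall v, 0 < q v) -> \sum_(v <- words k n) q v <= 1 ->
  word_entropy a n <= \sum_(v <- words k n) - ln (q v) * pr (cylinder S a v).
Proof.
move=> ma q0 q1; rewrite /word_entropy -sumrN -subr_ge0 -sumrB.
rewrite -oppr_le0 -sumrN.
rewrite (le_trans (y := \sum_(v <- words k n) (q v - pr (cylinder S a v))))//.
  apply: ler_sum => v _; rewrite -[leLHS]addr0.
  have := mul_ln_le (pr_ge0 mu (cylinder S a v)) (q0 v); lra.
by rewrite sumrB sum_pr_cylinder// subr_le0.
Qed.

Lemma word_entropy_ge0 a n : measurable_letter a -> 0 <= word_entropy a n.
Proof.
move=> ma; rewrite /word_entropy oppr_ge0 sumr_le0// => v _.
by rewrite mulr_ge0_le0 ?pr_ge0 ?ln_le0 ?pr_le1//; exact: measurable_cylinder.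
Qed.

(** The law of the itinerary under [b] in which each letter has been kept with
    probability [x] and redrawn uniformly otherwise: the noise absorbs the visits
    to the set where [b] need not agree with the letter to be coded, and no
    Hamming balls have to be counted. *)
Definition noisy_law (b : T -> 'I_k) (x : R) (v : seq 'I_k) : R :=
  \sum_(u <- words k (size v)) word_noise x v u * pr (cylinder S b u).

Lemma noisy_law_ge0 b x v : 0 <= x <= 1 -> 0 <= noisy_law b x v.
Proof.
by move=> x01; apply: sumr_ge0 => u _; rewrite mulr_ge0 ?word_noise_ge0 ?pr_ge0.
Qed.

Lemma sum_noisy_law b x n : measurable_letter b ->
  \sum_(v <- words k n) noisy_law b x v = 1.
Proof.
move=> mb; rewrite big_seq.
under eq_bigr => v do rewrite mem_words /noisy_law => /eqP ->.
rewrite -big_seq exchange_big/= -[RHS](sum_pr_cylinder n mb) !big_seq.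
apply: eq_bigr => u; rewrite mem_words => /eqP un.
by rewrite -mulr_suml sum_word_noise// mul1r.
Qed.

(** * Greedy parsing of itineraries *)

Section parse.
Variables (rel : T -> T -> Prop) (a b : T -> 'I_k) (U : set T).
Hypotheses (ma : measurable_letter a) (mb : measurable_letter b).
Hypotheses (mU : measurable U)
  (mball : forall n w, measurable (ball_along S rel n w)).
Hypothesis relU : forall w v, ~ U w -> rel w v -> b v = a w.

Local Notation p n w := (pr (ball_along S rel n w)).

(** [word_noise_along] bounds the noise from below on the whole ball; integration then produces the
    measure of the ball as a factor. *)
Lemma noisy_law_ge x n w : 0 <= x <= 1 ->
  p n w * (x ^+ n * ((1 - x) / k%:R) ^+ orbit_sum S (fun w => w \in U) n w) <=
  noisy_law b x (itinerary S a n w).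
Proof.
move=> x01; have /andP[x0 x1] := x01; set c := (X in _ * X <= _).
have c0 : 0 <= c by rewrite mulr_ge0 ?exprn_ge0// divr_ge0// subr_ge0.
rewrite /noisy_law size_itinerary mulrC.
have := @sum_pr_le _ _ _ mu _ _ [:: tt] (words k n) (fun=> c)
  (word_noise x (itinerary S a n w))
  (fun=> ball_along S rel n w) (cylinder S b).
rewrite big_seq1; apply => //.
- by move=> v; exact: measurable_cylinder.
- by move=> v; exact: word_noise_ge0.
move=> v; rewrite big_seq1 sum_cylinder indicE.
have [|_] := boolP (v \in _); last by rewrite mulr0 word_noise_ge0.
by rewrite inE mulr1 => /(word_noise_along x01 relU).
Qed.

(** A common lower bound for the factor [(1 - x) / k] of a wrong letter inside a
    block and the factor [1 / (2 k)] of a letter outside the blocks. *)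
Definition penalty (x : R) : R := (1 - x) / k%:R * (k%:R *+ 2)^-1.

Lemma letter_gt0 : (0 < k)%N.
Proof. by case: k a => // a' ; have := ltn_ord (a' point). Qed.

Lemma penalty_bounds x : 0 <= x < 1 -> [/\ 0 < penalty x <= 1,
  penalty x <= (1 - x) / k%:R & penalty x <= (k%:R *+ 2)^-1].
Proof.
move=> /andP[x0 x1]; have k0 := letter_gt0.
have k1 : 1 <= k%:R :> R by rewrite ler1n.
have h1 : 0 < (1 - x) / k%:R by rewrite divr_gt0 ?subr_gt0 ?(lt_le_trans _ k1).
have h2 : (1 - x) / k%:R <= 1.
  by rewrite ler_pdivrMr ?mul1r ?(lt_le_trans _ k1)//; lra.
have h3 : 0 < (k%:R *+ 2 : R)^-1 by rewrite invr_gt0 mulrn_wgt0// (lt_le_trans _ k1).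
have h4 : (k%:R *+ 2 : R)^-1 <= 1.
  by rewrite invf_le1 ?mulrn_wgt0// ?(lt_le_trans _ k1)//; lra.
split; first by rewrite mulr_gt0//= mulr_ile1// ltW.
- by rewrite ler_piMr// ltW.
- by rewrite ler_piMl// ltW.
Qed.

(** Points at which no block of length between [m] and [M] can start. *)
Definition bad_set (s : R) m M : set T :=
  [set w | forall n, (m <= n <= M)%N -> p n w <= s ^+ n].

(** Number of [penalty] factors reserved for one time step: one for a visit to [U], one for a point
    where no block starts. *)
Definition cost (s : R) m M (w : T) : nat :=
  (w \in U) + (w \in bad_set s m M).

(** A single parsing is followed greedily: at a time of positive cost one letter is read, otherwise
    a block with [s ^+ n < p n w] starts. The extra exponent [M] is a reserve for the end of the
    word. *)
Lemma parse_itinerary (x s : R) m M fuel N w :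
  0 <= x < 1 -> 0 <= s <= 1 -> (0 < m)%N -> (N <= fuel)%N ->
  (x ^+ 2 * s) ^+ N * penalty x ^+ (orbit_sum S (cost s m M) N w + M) <=
  parse_weight x m (noisy_law b x) fuel (itinerary S a N w).
Proof.
move=> x01 s01 m0.
have /andP[x0 x1] := x01; have /andP[s0 s1] := s01.
have x01' : 0 <= x <= 1 by rewrite x0 ltW.
have [/andP[E0 E1] E2 E3] := penalty_bounds x01.
set E := penalty x in E0 E1 E2 E3 *.
have th0 v : 0 <= noisy_law b x v by exact: noisy_law_ge0.
have nu0 := parse_weight_ge0 m x01' th0.
have y0 : 0 <= x ^+ 2 * s by rewrite mulr_ge0// exprn_ge0.
have y1 : x ^+ 2 * s <= 1 by rewrite mulr_ile1 ?exprn_ge0// exprn_ile1// ltW.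
elim: fuel N w => [|f IH] [|N] w Nf //.
- by rewrite /orbit_sum big_ord0 mul1r exprn_ile1// ltW.
- by rewrite /orbit_sum big_ord0 mul1r exprn_ile1// ltW.
have [c0|cn0] := boolP (cost s m M w == 0)%N; last first.
  have -> : itinerary S a N.+1 w = a w :: itinerary S a N (S w) by [].
  apply: le_trans (parse_weight_cons m x01' th0 f _ _).
  rewrite orbit_sumS exprS -addnA exprD mulrACA.
  apply: ler_pM; rewrite ?mulr_ge0 ?exprn_ge0 ?(ltW E0)//; last exact: IH.
  rewrite (le_trans _ E3)// -[leRHS]mul1r ler_pM ?exprn_ge0 ?(ltW E0)//.
  rewrite -[leRHS]expr1 ler_wiXn2l ?(ltW E0)//.
  by rewrite lt0n.
have [n] : exists n, [/\ (m <= n <= M)%N & s ^+ n < p n w].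
  apply: contrapT => h; move: c0; apply/negP; rewrite /cost.
  rewrite [w \in bad_set _ _ _]mem_set ?addn1// => n nmM.
  by rewrite leNgt; apply/negP => sp; apply: h; exists n.
move=> [/andP[mn nM] spn].
have n0 : (0 < n)%N by rewrite (leq_trans m0).
have costU v : ((v \in U) <= cost s m M v)%N by rewrite leq_addr.
(* If the block does not fit, fewer than [M] letters remain, and reading them one by one uses the
   reserve. *)
have [Nn|nN] := ltnP N.+1 n.
  apply: le_trans (parse_weight_ge m x01' th0 f.+1 _ letter_gt0).
  rewrite size_itinerary (le_trans (y := 1 * E ^+ N.+1))//; last first.
    by rewrite mul1r lerXn2r// nnegrE ?(ltW E0)// (le_trans (ltW E0)).
  apply: ler_pM; rewrite ?exprn_ge0 ?exprn_ile1 ?(ltW E0)//.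
  rewrite ler_wiXn2l ?(ltW E0)// (leq_trans (ltnW Nn))// (leq_trans nM)//.
  exact: leq_addl.
have blk := @parse_weight_block _ _ _ _ _ x01' th0 f (itinerary S a N.+1 w) n mn.
apply: le_trans (blk _); last by rewrite n0 size_itinerary.
rewrite take_itinerary// drop_itinerary -{1 2}(subnKC nN) orbit_sum_add -addnA.
rewrite [E ^+ _]exprD [_ ^+ (n + _)]exprD mulrACA.
(* One factor [x ^+ n] is the length cost in [parse_weight], the other comes from the kept letters
   in [noisy_law_ge]. *)
have -> : (x ^+ 2 * s) ^+ n = x ^+ n * (x ^+ n * s ^+ n).
  by rewrite exprMn expr2 exprMn mulrA.
rewrite -!mulrA ler_wpM2l ?exprn_ge0// !mulrA -mulrA; apply: ler_pM.
- by rewrite !mulr_ge0 ?exprn_ge0// ltW.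
- by rewrite !mulr_ge0 ?exprn_ge0// ltW.
- rewrite (le_trans _ (noisy_law_ge n w x01'))// -mulrA [leRHS]mulrCA.
  rewrite ler_wpM2l ?exprn_ge0//.
  apply: ler_pM; rewrite ?exprn_ge0 ?(ltW E0) ?(ltW spn)//.
  rewrite (le_trans (y := E ^+ orbit_sum S (fun w => w \in U) n w))//.
    by rewrite ler_wiXn2l ?(ltW E0)// leq_sum.
  by rewrite lerXn2r// nnegrE ?(ltW E0)// (le_trans (ltW E0)).
- apply: IH; rewrite -ltnS (leq_trans _ Nf)// ltnS.
  by case: n n0 {blk mn nM spn nN} => // n _; rewrite subSS leq_subr.
Qed.

End parse.
End entropy_rate.

Lemma ln_parse_bound {R : realType} (x r E : R) (N C : nat) : 0 < x -> 0 < E ->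
  ln ((x ^+ 2 * expR (- r)) ^+ N * E ^+ C) =
  N%:R * (2 * ln x - r) + C%:R * ln E.
Proof.
move=> x0 E0; have y0 : 0 < x ^+ 2 * expR (- r).
  by rewrite mulr_gt0 ?exprn_gt0 ?expR_gt0.
rewrite lnM ?posrE ?exprn_gt0// !lnXn// lnM ?posrE ?exprn_gt0 ?expR_gt0//.
rewrite lnXn// expRK -[ln E *+ C]mulr_natl -[ln x *+ 2]mulr_natl.
by rewrite -[(_ - r) *+ N]mulr_natl.
Qed.

(** * Zero-one law for the growth rate and the entropy bound *)

Section growth.
Context {d : measure_display} {T : measurableType d} {R : realType}.
Variables (mu : probability T R) (S : T -> T) (k : nat).
Hypotheses (mS : measurable_fun [set: T] S) (muS : invariant_measure mu S).
Local Notation pr := (pr mu).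

Section relation.
Variable rel : T -> T -> Prop.
Hypotheses (mball : forall n w, measurable (ball_along S rel n w))
  (mp : forall n t, measurable [set w | t < pr (ball_along S rel n w)]).
Local Notation p n w := (pr (ball_along S rel n w)).

Definition frequently_large (r : R) : set T :=
  [set w | forall m, exists2 n, (m <= n)%N & expR (- r) ^+ n < p n w].

Lemma measurable_limsup (F : nat -> set T) : (forall n, measurable (F n)) ->
  measurable [set w | forall m, exists2 n, (m <= n)%N & F n w].
Proof.
move=> mF.
rewrite (_ : [set _ | _] = \bigcap_m \bigcup_(n in [set n | (m <= n)%N]) F n).
  by apply: bigcapT_measurable => m; exact: bigcup_measurable.
apply/seteqP; split => w h m; first by move=> _; have [n] := h m; exists n.
by have [n] := h m I; exists n.
Qed.

Lemma measurable_frequently_large r : measurable (frequently_large r).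
Proof. by apply: measurable_limsup => n; exact: mp. Qed.

Lemma ball_along_shift n w : p n.+1 w <= p n (S w).
Proof.
rewrite -(pr_preimage muS (mball n (S w))) le_pr//.
  exact: measurable_preimage.
exact: ball_alongS.
Qed.

(** The shift turns [n.+1] into [n], which changes the bound by a constant factor. Allowing any
    factor [exp (- C)] gives a set [A] contained in its preimage, to which [pr_subinvariant]
    applies; the gap [r' - r] then absorbs [C]. *)
Lemma frequently_large_full r r' : ergodic_measure mu S -> r < r' ->
  0 < pr (frequently_large r) -> pr (frequently_large r') = 1.
Proof.
move=> erg rr' pos.
pose F C n := [set w | expR (- (r * n%:R + C%:R)) < p n w].
pose A := \bigcup_C [set w | forall m, exists2 n, (m <= n)%N & F C n w].
have mA : measurable A.
  apply: bigcupT_measurable => C; apply: measurable_limsup => n; exact: mp.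
have sub : A `<=` S @^-1` A.
  move=> w [C _ h].
  (* Passing from [n.+1] to [n] changes the exponent by [r], so the constant grows by more than
     [r]. *)
  exists (C + Num.truncn `|r|).+1 => // m.
  have [[|n] //] := h m.+1; rewrite ltnS => mn hn.
  exists n => //; apply: le_lt_trans (lt_le_trans hn (ball_along_shift n w)).
  rewrite ler_expR lerN2.
  have rt : r < (Num.truncn `|r|).+1%:R.
    by rewrite (le_lt_trans (ler_norm _))// truncnS_gt.
  rewrite -addnS -natr1 natrD mulrDr mulr1; lra.
have fA : frequently_large r `<=` A.
  move=> w h; exists 0%N => // m; have [n mn hn] := h m; exists n => //.
  by rewrite /F/= addr0 -mulNr mulrC expRM_natl.
have A1 : pr A = 1.
  apply: (pr_subinvariant mS muS erg mA sub).
  exact: lt_le_trans pos (le_pr mu (measurable_frequently_large r) mA fA).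
apply/eqP; rewrite eq_le (pr_le1 mu (measurable_frequently_large _))/= -A1.
apply: (le_pr mu mA (measurable_frequently_large _)).
move=> w [C _ h] m.
(* From this index on, [C < (r' - r) * n]. *)
have [n mn hn] := h (m + Num.truncn (C%:R / (r' - r))).+1.
exists n; first by rewrite (leq_trans _ mn)// -addnS leq_addr.
apply: le_lt_trans hn; rewrite -expRM_natl mulrN ler_expR lerN2.
have : C%:R / (r' - r) < n%:R.
  by rewrite (lt_le_trans (truncnS_gt _))// ler_nat (leq_trans _ mn)// ltnS leq_addl.
rewrite ltr_pdivrMr ?subr_gt0//; lra.
Qed.

Section letters.
Variables (a b : T -> 'I_k) (U : set T).
Hypotheses (ma : measurable_letter a) (mb : measurable_letter b).
Hypotheses (mU : measurable U)
  (relU : forall w v, ~ U w -> rel w v -> b v = a w).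

Lemma measurable_bad_set s m M : measurable (bad_set mu S rel s m M).
Proof.
rewrite (_ : bad_set _ _ _ _ _ _ = \bigcap_(n in [set n | (m <= n <= M)%N])
    ~` [set w | s ^+ n < p n w]).
  by apply: bigcap_measurableType => n _; exact/measurableC/mp.
apply/seteqP; split => w h n nM; first by apply/negP; rewrite -leNgt; exact: h.
by rewrite leNgt; apply/negP; exact: h.
Qed.

(** The bad sets decrease in [M], and a point common to all of them lies outside
    [frequently_large r]. *)
Lemma bad_set_small r m eta : pr (frequently_large r) = 1 -> 0 < eta ->
  exists M, pr (bad_set mu S rel (expR (- r)) m M) < eta.
Proof.
move=> full eta0; apply: pr_nonincreasing_lt.
- by move=> M; exact: measurable_bad_set.
- move=> i j ij w h n /andP[mn nj]; apply: h.
  by rewrite mn (leq_trans nj).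
- apply: le_lt_trans eta0.
  have mI : measurable (\bigcap_M bad_set mu S rel (expR (- r)) m M).
    by apply: bigcapT_measurable => M; exact: measurable_bad_set.
  rewrite -[leRHS](subrr 1) -{2}full -(prC mu (measurable_frequently_large r)).
  apply: le_pr => //; first exact/measurableC/measurable_frequently_large.
  move=> w h /(_ m)[n mn]; apply/negP; rewrite -leNgt.
  by apply: (h n) => //; rewrite mn leqnn.
Qed.

Lemma orbit_sum_cost s m M N w :
  (orbit_sum S (cost mu S rel U s m M) N w)%:R =
  \sum_(i < N) \1_(iter i S @^-1` U) w +
  \sum_(i < N) \1_(iter i S @^-1` bad_set mu S rel s m M) w :> R.
Proof. by rewrite -!orbit_sum_mem -natrD /orbit_sum -big_split. Qed.

(** Gibbs' inequality against the parse weight. [parse_itinerary] bounds its logarithm pointwise; by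
    invariance the visits to [U] and to the bad set have means [N * pr U] and at most [N * eta]. The
    reserve [M] becomes the constant [K]. *)
Lemma word_entropy_rate_le r x eta : 0 <= r -> pr (frequently_large r) = 1 ->
  0 < x < 1 -> 0 < eta -> exists K, forall N, word_entropy mu S a N <=
    N%:R * (r - 2 * ln x - ln (penalty k x) * (pr U + eta)) + K.
Proof.
move=> r0 full /andP[x0 x1] eta0.
have x01 : 0 <= x < 1 by rewrite ltW.
have [m hm] := geometric_tail x01.
have [M hM] := bad_set_small m.+1 full eta0.
have x01' : 0 <= x <= 1 by rewrite !ltW.
have [/andP[E0 E1] _ _] := penalty_bounds a x01.
set E := penalty k x in E0 E1 *.
set s := expR (- r) in hM.
have s01 : 0 <= s <= 1 by rewrite expR_ge0 -expR0 ler_expR oppr_le0.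
pose q v := parse_weight x m.+1 (noisy_law mu S b x) (size v) v.
have th0 v : 0 <= noisy_law mu S b x v by exact: noisy_law_ge0.
have th1 n : \sum_(v <- words k n) noisy_law mu S b x v <= 1.
  by rewrite sum_noisy_law.
have k0 := letter_gt0 a.
have q0 v : 0 < q v.
  apply: lt_le_trans (parse_weight_ge _ x01' th0 _ _ k0).
  by rewrite exprn_gt0// invr_gt0 mulrn_wgt0// ltr0n.
have sumq N : \sum_(v <- words k N) q v <= 1.
  apply: le_trans (sum_parse_weight x01' th0 th1 hm (leqnn N)).
  rewrite !big_seq; apply: ler_sum => v; rewrite mem_words /q => /eqP ->.
  exact: lexx.
have q1 v : q v <= 1.
  apply: le_trans (sumq (size v)).
  rewrite (bigD1_seq v) ?uniq_words ?mem_words//= lerDl sumr_ge0// => u _.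
  exact/ltW/q0.
have bound1 (n l u e i v : R) : n * (2 * l - r) + (u + i) * e <= v ->
  - v <= n * (r - 2 * l) - e * i + - e * u by lra.
have bound2 (n l u e i v : R) : n * - e * v <= n * - e * eta ->
  n * (r - 2 * l) - e * i + (- e * (n * u) + - e * (n * v)) <=
  n * (r - 2 * l - e * (u + eta)) + - e * i by lra.
exists (- ln E * M%:R) => N.
apply: le_trans (word_entropy_le mu mS ma q0 (sumq N)) _.
have lnE : 0 <= - ln E by rewrite oppr_ge0 ln_le0.
pose Bad := bad_set mu S rel s m.+1 M.
have mBad : measurable Bad by exact: measurable_bad_set.
pose c0 := N%:R * (r - 2 * ln x) - ln E * M%:R.
have c00 : 0 <= c0.
  have lnx : ln x <= 0 by rewrite ln_le0// ltW.
  rewrite /c0 -[- (ln E * _)]mulNr addr_ge0 ?mulr_ge0//.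
  by lra.
(* The pointwise bound as one simple function: [None] indexes the constant, [inl i] and [inr i] the
   visits at time [i] to [U] and to the bad set. *)
pose J := option ('I_N + 'I_N).
pose t : seq J := None :: [seq Some (inl i) | i <- index_enum 'I_N] ++
  [seq Some (inr i) | i <- index_enum 'I_N].
pose e (j : J) : R := if j is None then c0 else - ln E.
pose B (j : J) : set T := match j with
  | None => setT
  | Some (inl i) => iter i S @^-1` U
  | Some (inr i) => iter i S @^-1` Bad
  end.
have mB j : measurable (B j).
  by case: j => [[]|] //= i; exact: measurable_iter_preimage.
have e0 j : 0 <= e j by case: j.
rewrite (le_trans (y := \sum_(j <- t) e j * pr (B j)))//.
  apply: (@sum_pr_le _ _ _ mu _ _ _ t (fun v => - ln (q v)) e) => //.
  - by move=> v; exact: measurable_cylinder.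
  - by move=> v; rewrite oppr_ge0 ln_le0.
  move=> w; rewrite (sum_cylinder S a N w (fun v => - ln (q v))).
  rewrite /t big_cons big_cat !big_map/= indicT mulr1.
  rewrite -!mulr_sumr -mulrDr -orbit_sum_cost.
  have := parse_itinerary mu mS mb mball relU M w x01 s01 (ltn0Sn m) (leqnn N).
  rewrite -/E /q size_itinerary => h.
  have := h; rewrite -ler_ln ?posrE//; last 2 first.
  - by rewrite mulr_gt0 ?exprn_gt0// mulr_gt0 ?exprn_gt0 ?expR_gt0.
  - have := q0 (itinerary S a N w); by rewrite /q size_itinerary.
  rewrite ln_parse_bound// natrD; exact: bound1.
rewrite /t big_cons big_cat !big_map/= prT mulr1 -!mulr_sumr.
rewrite !(sum_pr_iter mS muS)// /c0.
by apply: bound2; rewrite ler_wpM2l ?mulr_ge0// ltW.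
Qed.

End letters.
End relation.
End growth.

(** Budget of [ae_eventually_cylinder_ge], per letter: of the gap [3 * g] above the entropy [h], the
    block rate takes [g], three powers of [x = exp (- (g / 6))] take [g / 2], the [j] bad times
    [g / 2] and the reserve [i] takes [g]. *)
Lemma exponent_bound {R : realType} (h g l i j t u : R) : - l * i <= g * u ->
  j * - l <= t * u * - l -> t * - l * u <= g / 2 * u ->
  u * - (h + 3 * g) <=
    u * - (g / 6) + (u * (2 * - (g / 6) - (h + g)) + (j + i) * l).
Proof. lra. Qed.

(** * Convergence of normalized entropies and almost sure growth of cylinders *)

Section entropy_growth.
Context {d : measure_display} {T : measurableType d} {R : realType}.
Variables (mu : probability T R) (S : T -> T) (k : nat).
Hypotheses (mS : measurable_fun [set: T] S) (muS : invariant_measure mu S).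
Local Notation pr := (pr mu).

(** With [x = exp (- (e / 8))], the penalties on a set of this measure cost at most [e / 4] per
    letter. The 1 in the denominator keeps it positive. *)
Definition tolerance (e : R) : R :=
  e / 4 / (1 - ln (penalty k (expR (- (e / 8))))).

Lemma tolerance_gt0 (a : T -> 'I_k) e : 0 < e -> 0 < tolerance e.
Proof.
move=> e0; rewrite /tolerance.
have [|/andP[E0 E1] _ _] := @penalty_bounds _ T R k a (expR (- (e / 8))).
  by rewrite expR_ge0 -expR0 ltr_expR oppr_lt0 divr_gt0.
by rewrite divr_gt0 ?divr_gt0// ltr_pwDl// oppr_ge0 ln_le0.
Qed.

(** The surplus [e] splits into quarters: [- 2 * ln x], the visits to [U], the visits to the bad
    set, and [K / n]. *)
Lemma word_entropy_eventually_le rel (a b : T -> 'I_k) (U : set T) (r e : R) :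
  (forall n w, measurable (ball_along S rel n w)) ->
  (forall n t, measurable [set w | t < pr (ball_along S rel n w)]) ->
  measurable_letter a -> measurable_letter b -> measurable U ->
  (forall w v, ~ U w -> rel w v -> b v = a w) ->
  0 <= r -> pr (frequently_large mu S rel r) = 1 -> 0 < e ->
  pr U <= tolerance e ->
  exists N, forall n, (N <= n)%N -> word_entropy mu S a n <= (r + e) * n%:R.
Proof.
move=> mball mp ma mb mU relU r0 full e0 hU.
set x := expR (- (e / 8)).
have x01 : 0 < x < 1.
  by rewrite expR_gt0 -expR0 ltr_expR oppr_lt0 divr_gt0.
have [|/andP[E0 E1] _ _] := @penalty_bounds _ T R k a x.
  by move/andP: x01 => [/ltW -> ->].
set l := - ln (penalty k x).
have l0 : 0 <= l by rewrite oppr_ge0 ln_le0.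
have t0 := tolerance_gt0 a e0.
have [K hK] := word_entropy_rate_le mS muS mball mp ma mb mU relU r0 full x01 t0.
have hl : l * (pr U + tolerance e) <= e / 2.
  have : l * tolerance e <= e / 4.
    rewrite /tolerance -/x -/l mulrCA ger_pMr ?divr_gt0// ler_pdivrMr; last first.
      by rewrite ltr_pwDl.
    by rewrite mul1r lerDr.
  have : l * pr U <= l * tolerance e by rewrite ler_wpM2l.
  rewrite mulrDr; lra.
exists (Num.truncn (`|K| / (e / 4))).+1 => n hn.
apply: le_trans (hK n) _.
have Kn : K <= n%:R * (e / 4).
  rewrite (le_trans (ler_norm K))// -ler_pdivrMr ?divr_gt0//.
  by rewrite (le_trans (ltW (truncnS_gt _)))// ler_nat.
have lnx : 2 * ln x = - (e / 4) by rewrite /x expRK; field.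
rewrite lnx -[- (ln (penalty k x) * _)]mulNr -/l.
have h := ler_wpM2l (ler0n R n) hl.
rewrite mulrDr; lra.
Qed.

Definition same_letter (a : T -> 'I_k) (w v : T) : Prop := a v = a w.

Lemma ball_same_letter a n w :
  ball_along S (same_letter a) n w = cylinder S a (itinerary S a n w).
Proof.
rewrite /cylinder size_itinerary; apply/seteqP; split => v /=.
  elim: n w v => //= n IH w v h; congr cons; first exact: (h 0%N).
  by apply: IH => i ilen; rewrite /same_letter -!iterSr; exact: (h i.+1).
elim: n w v => //= n IH w v [h0 h] [|i] //; rewrite ltnS => ilen.
by rewrite /same_letter !iterSr; exact: IH.
Qed.

Lemma measurable_itinerary a n (P : seq 'I_k -> Prop) : measurable_letter a ->
  measurable [set w | P (itinerary S a n w)].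
Proof.
move=> ma; elim: n P => [|n IH] P /=.
  have [h|h] := pselect (P [::]).
    by rewrite (_ : [set _ | _] = setT)//; apply/seteqP; split.
  by rewrite (_ : [set _ | _] = set0)//; apply/seteqP; split.
rewrite (_ : [set _ | _] = \bigcup_(i in [set: 'I_k]) (a @^-1` [set i] `&`
    S @^-1` [set w | P (i :: itinerary S a n w)])).
  apply: fin_bigcup_measurable => // i _; apply: measurableI => //.
  by apply: measurable_preimage => //; exact: (IH (fun v => P (i :: v))).
apply/seteqP; split => w /=; first by move=> h; exists (a w).
by move=> [i _ [/= ->]].
Qed.

Section letter.
Variable a : T -> 'I_k.
Hypothesis ma : measurable_letter a.
Local Notation p n w := (pr (ball_along S (same_letter a) n w)).
Local Notation H := (word_entropy mu S a).

Lemma measurable_ball_same_letter n w :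
  measurable (ball_along S (same_letter a) n w).
Proof. by rewrite ball_same_letter; exact: measurable_cylinder. Qed.

Lemma measurable_pr_ball_same_letter n t : measurable [set w | t < p n w].
Proof.
under eq_set do rewrite ball_same_letter.
exact: (measurable_itinerary n (fun v => t < pr (cylinder S a v))).
Qed.

Let mball := measurable_ball_same_letter.
Let mp := measurable_pr_ball_same_letter.

(** Gibbs' inequality against the uniform law on words. *)
Lemma word_entropy_linear : exists C, forall n, H n <= C * n%:R.
Proof.
have k0 := letter_gt0 a.
exists (ln k%:R) => n.
have sum1 m : \sum_(v <- words k m) (k%:R : R)^-1 ^+ size v <= 1.
  elim: m => [|m IH]; first by rewrite sum_words0.
  rewrite sum_words_cons/=.
  under eq_bigr do under eq_bigr do rewrite exprS.
  under eq_bigr do rewrite -mulr_sumr.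
  rewrite sumr_const card_ord -mulrnAl -[_^-1 *+ k]mulr_natl divff ?mul1r//.
  by rewrite pnatr_eq0 -lt0n.
apply: le_trans (word_entropy_le mu mS ma _ (sum1 n)) _.
  by move=> v; rewrite exprn_gt0// invr_gt0 ltr0n.
rewrite big_seq.
under eq_bigr => v do rewrite mem_words => /eqP ->.
rewrite -big_seq -mulr_sumr sum_pr_cylinder// mulr1 lnXn ?invr_gt0 ?ltr0n//.
by rewrite lnV ?posrE ?ltr0n// mulNrn opprK mulr_natr.
Qed.

(** Markov's inequality for the information function [- ln (p n w)], whose mean is [H n]. *)
Lemma word_entropy_markov r n : 0 < r ->
  r * n%:R * pr (~` [set w | expR (- r) ^+ n < p n w]) <= H n.
Proof.
move=> r0.
(* Since [ln 0 = 0], null cylinders receive the value [r * n] instead, so that the inequality holds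
   at every point; the mean is unchanged. *)
pose c v := if pr (cylinder S a v) == 0 then r * n%:R
  else - ln (pr (cylinder S a v)).
have c0 v : 0 <= c v.
  rewrite /c; case: ifPn => _; first by rewrite mulr_ge0 ?(ltW r0).
  by rewrite oppr_ge0 ln_le0 ?pr_le1//; exact: measurable_cylinder.
rewrite (_ : H n = \sum_(v <- words k n) c v * pr (cylinder S a v)); last first.
  rewrite /word_entropy -sumrN; apply: eq_bigr => v _; rewrite /c.
  by case: eqVneq => [->|_]; rewrite ?mul0r ?mulr0 ?oppr0// mulNr mulrC.
have := @sum_pr_le _ _ _ mu _ _ [:: tt] (words k n) (fun=> r * n%:R) c
  (fun=> ~` [set w | expR (- r) ^+ n < p n w]) (cylinder S a).
rewrite big_seq1; apply => //.
- by move=> _; exact/measurableC/mp.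
- by move=> v; exact: measurable_cylinder.
- by move=> _; rewrite mulr_ge0 ?(ltW r0).
move=> w; rewrite big_seq1 (sum_cylinder S a n w c) indicE.
have [|_] := boolP (w \in _); last by rewrite mulr0.
rewrite inE mulr1 /= => /negP; rewrite -leNgt ball_same_letter => h.
rewrite /c; case: ifPn => // pn0.
have p0 : 0 < pr (cylinder S a (itinerary S a n w)) by rewrite lt_def pn0 pr_ge0.
rewrite lerNr; apply: le_trans (_ : _ <= ln (expR (- r) ^+ n)) _.
  by rewrite ler_ln ?posrE// exprn_gt0// expR_gt0.
by rewrite lnXn ?expR_gt0// expRK mulNrn mulr_natr.
Qed.

(** At the intermediate rate [s], Markov's inequality gives probability at least [1 - r / s] for
    infinitely many [n], hence for the limit superior; [frequently_large_full] raises it to 1. *)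
Lemma frequently_large_entropy r r' : ergodic_measure mu S -> 0 < r < r' ->
  (forall m, exists2 n, (m <= n)%N & H n <= r * n%:R) ->
  pr (frequently_large mu S (same_letter a) r') = 1.
Proof.
move=> erg /andP[r0 rr'] h.
pose s := (r + r') / 2; have rs : r < s by rewrite /s; lra.
have s0 : 0 < s by exact: lt_trans rs.
apply: (frequently_large_full mS muS mball mp erg (r := s)).
  by rewrite /s; lra.
have c0 : 0 < 1 - r / s by rewrite subr_gt0 ltr_pdivrMr// mul1r.
apply: lt_le_trans c0 _.
rewrite (_ : frequently_large _ _ _ _ = \bigcap_m \bigcup_(n in [set n | (m <= n)%N])
  [set w | expR (- s) ^+ n < p n w]); last first.
  apply/seteqP; split => w hw m; first by move=> _; have [n] := hw m; exists n.
  by have [n] := hw m I; exists n.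
apply: (@pr_limsup_ge _ _ _ mu _ (fun n => [set w | expR (- s) ^+ n < p n w])) => [n|m].
  exact: mp.
have [n mn hn] := h m.+1; exists n; first exact: ltnW.
rewrite -[X in pr X]setCK prC; last exact/measurableC/mp.
rewrite lerD2l lerN2 ler_pdivlMr//.
have n0 : 0 < n%:R :> R by rewrite ltr0n (leq_trans _ mn).
rewrite -(ler_pM2r n0) (le_trans _ hn)// (le_trans _ (word_entropy_markov n s0))//.
by rewrite [leRHS]mulrC -(mulrA _ s).
Qed.

Definition entropy_rate : R := limn (fun n => H n / n%:R).

(** The infimum of [A] is the lower limit of [H n / n]. A rate just above it is met infinitely
    often, which makes [frequently_large] full, and the entropy bound with [U] empty turns this into
    an eventual upper bound. *)
Let entropy_rate_spec : ergodic_measure mu S ->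
  (fun n => H n / n%:R) @ \oo --> entropy_rate /\ 0 <= entropy_rate.
Proof.
move=> erg.
pose A := [set r : R | 0 < r /\ forall m, exists2 n, (m <= n)%N & H n <= r * n%:R].
have [C hC] := word_entropy_linear.
have A0 : A !=set0.
  exists (`|C| + 1); split; first by rewrite ltr_wpDl.
  move=> m; exists m => //; rewrite (le_trans (hC m))// ler_wpM2r//.
  by rewrite (le_trans (ler_norm _))// lerDl.
have lbA : lbound A 0 by move=> r [/ltW].
have infA : has_inf A by split => //; exists 0.
pose l := inf A.
have l0 : 0 <= l by exact: lb_le_inf.
suff cv : (fun n => H n / n%:R) @ \oo --> l.
  by rewrite /entropy_rate (cvg_lim (@Rhausdorff R) cv).
apply/cvgrPdist_le => e e0.
have [N1 hN1] : exists N, forall n, (N <= n)%N -> (l - e) * n%:R <= H n.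
  have [le0|lpos] := leP (l - e) 0.
    exists 0%N => n _; rewrite (le_trans _ (word_entropy_ge0 mu mS n ma))//.
    by rewrite mulr_le0_ge0.
  have nA : ~ A (l - e).
    by move=> /(ge_inf infA.2); rewrite leNgt gtrBl e0.
  apply: contrapT => h; apply: nA; split => // m.
  apply: contrapT => h'; apply: h; exists m => n mn.
  by rewrite leNgt; apply/negP => /ltW lt; apply: h'; exists n.
have [N2 hN2] : exists N, forall n, (N <= n)%N -> H n <= (l + e) * n%:R.
  have [|r [r0 Ar] rl] := @inf_adherent _ A (e / 3) _ infA.
    by rewrite divr_gt0.
  have full := frequently_large_entropy erg (r := r) (r' := l + e / 2) _ Ar.
  have h0 : pr set0 <= tolerance (e / 2).
    by rewrite /pr measure0 ltW// tolerance_gt0// divr_gt0.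
  have [||||N hN] := word_entropy_eventually_le mball mp ma ma
    measurable0 (U := set0) (r := l + e / 2) (e := e / 2) _ _ _ _ h0 => //.
  - by rewrite addr_ge0// divr_ge0// ltW.
  - by apply: full; rewrite r0/=; lra.
  - by rewrite divr_gt0.
  by exists N => n /hN; rewrite -addrA -splitr.
near=> n.
have n0 : 0 < n%:R :> R by rewrite ltr0n; near: n; exists 1%N.
rewrite ler_distlC ler_pdivlMr// ler_pdivrMr//; apply/andP; split.
  by apply: hN1; near: n; exists N1.
by apply: hN2; near: n; exists N2.
Unshelve. all: by end_near. Qed.

Lemma cvg_entropy_rate : ergodic_measure mu S ->
  (fun n => H n / n%:R) @ \oo --> entropy_rate.
Proof. by move=> /entropy_rate_spec[]. Qed.

Lemma entropy_rate_ge0 : ergodic_measure mu S -> 0 <= entropy_rate.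
Proof. by move=> /entropy_rate_spec[]. Qed.


(** Otherwise the zero-one law gives full measure at rate [r + e], and the entropy bound forces
    [entropy_rate <= r + 2 * e]. *)
Lemma pr_frequently_large_eq0 rel (b : T -> 'I_k) (U : set T) (r e : R) :
  ergodic_measure mu S ->
  (forall n w, measurable (ball_along S rel n w)) ->
  (forall n t, measurable [set w | t < pr (ball_along S rel n w)]) ->
  measurable_letter b -> measurable U ->
  (forall w v, ~ U w -> rel w v -> b v = a w) ->
  0 <= r -> 0 < e -> pr U <= tolerance e -> r + 2 * e < entropy_rate ->
  pr (frequently_large mu S rel r) = 0.
Proof.
move=> erg mb' mp' mb mU relU r0 e0 hU hr.
apply/eqP; rewrite eq_le pr_ge0 andbT leNgt; apply/negP => pos.
have re : r < r + e by rewrite ltrDl.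
have full := frequently_large_full mS muS mb' mp' erg re pos.
have re0 : 0 <= r + e by rewrite addr_ge0// ltW.
have [N hN] := word_entropy_eventually_le mb' mp' ma mb mU relU re0 full e0 hU.
suff : entropy_rate <= r + 2 * e by rewrite leNgt hr.
have cv := cvg_entropy_rate erg.
apply: limr_le; first exact: cvgP cv.
near=> n.
have n0 : 0 < n%:R :> R by rewrite ltr0n; near: n; exists 1%N.
rewrite ler_pdivrMr// (_ : r + 2 * e = r + e + e); last by ring.
by apply: hN; near: n; exists N.
Unshelve. all: by end_near. Qed.

(** Cylinders eventually dominate [x ^+ n] times the parse weight, which is large along an itinerary
    unless some average of visits to the bad set reaches [t]. The maximal inequality makes such
    points rarer than any exceptional set of positive measure. *)
Lemma ae_eventually_cylinder_ge r : ergodic_measure mu S -> entropy_rate < r ->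
  {ae mu, forall w, exists N, forall n, (N <= n)%N -> expR (- r) ^+ n <= p n w}.
Proof.
move=> erg hr.
have rate0 := entropy_rate_ge0 erg.
have [g g0 gr] : exists2 g, 0 < g & r = entropy_rate + 3 * g.
  exists ((r - entropy_rate) / 3); first by rewrite divr_gt0 ?subr_gt0.
  by field.
pose r' := entropy_rate + g.
have r'0 : 0 <= r' by rewrite addr_ge0// ltW.
have full : pr (frequently_large mu S (same_letter a) r') = 1.
  apply: (@frequently_large_entropy (entropy_rate + g / 2)) => //.
    by rewrite ltr_wpDl//= ?divr_gt0// /r'; lra.
  move=> m; have /cvgr_le := cvg_entropy_rate erg.
  move=> /(_ (entropy_rate + g / 2)) [|N _ hN].
    by rewrite ltrDl divr_gt0.
  exists (maxn N m.+1); first by rewrite leq_max leqnSn orbT.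
  have := hN (maxn N m.+1) (leq_maxl _ _).
  by rewrite /= ler_pdivrMr// ltr0n leq_max orbT.
pose x := expR (- (g / 6)).
have x0 : 0 < x by exact: expR_gt0.
have x1 : x < 1 by rewrite -expR0 ltr_expR oppr_lt0 divr_gt0.
have x01 : 0 <= x < 1 by rewrite ltW.
have x01' : 0 <= x <= 1 by rewrite !ltW.
have [m hm] := geometric_tail x01.
have [/andP[E0 E1] _ _] := penalty_bounds a x01.
set E := penalty k x in E0 E1.
have l0 : 0 <= - ln E by rewrite oppr_ge0 ln_le0.
(* A frequency [t] of bad times costs at most [g / 2] per letter. *)
pose t := g / 2 / (1 - ln E).
have t0 : 0 < t by rewrite /t divr_gt0 ?ltr_pwDl// divr_gt0.
have tl : t * - ln E <= g / 2.
  rewrite /t -mulrA ger_pMr ?divr_gt0// mulrC ler_pdivrMr ?ltr_pwDl//.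
  by rewrite mul1r lerDr.
have s01 : 0 <= expR (- r') <= 1 by rewrite expR_ge0 -expR0 ler_expR oppr_le0.
pose theta := noisy_law mu S a x.
have th0 v : 0 <= theta v by exact: noisy_law_ge0.
have th1 n : \sum_(v <- words k n) theta v <= 1 by rewrite sum_noisy_law.
pose nu n v := parse_weight x m.+1 theta n v.
have nu0 n v : 0 <= nu n v by exact: parse_weight_ge0.
have nu1 n : \sum_(v <- words k n) nu n v <= 1.
  exact: sum_parse_weight th1 hm _ _ (leqnn n).
(* [F n] has measure at most [x ^+ n] since the weights sum to at most 1; by
   Borel-Cantelli the cylinders eventually dominate the parse weight. *)
pose F n := [set w | p n w < x ^+ n * nu n (itinerary S a n w)].
have mF n : measurable (F n).
  rewrite /F; under eq_set do rewrite ball_same_letter.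
  exact: (measurable_itinerary n
    (fun v => pr (cylinder S a v) < x ^+ n * nu n v)).
have prF n : pr (F n) <= x ^+ n.
  pose c v := (pr (cylinder S a v) < x ^+ n * nu n v)%R%:R : R.
  have h : 1 * pr (F n) <= \sum_(v <- words k n) c v * pr (cylinder S a v).
    have := @sum_pr_le _ _ _ mu _ _ [:: tt] (words k n) (fun=> 1) c
      (fun=> F n) (cylinder S a).
    rewrite big_seq1; apply => //.
    - by move=> v; exact: measurable_cylinder.
    move=> w; rewrite big_seq1 (sum_cylinder S a n w c) mul1r indicE.
    have [|//] := boolP (w \in F n).
    by rewrite inE /F/= ball_same_letter /c => ->.
  rewrite -[leLHS]mul1r (le_trans h)//.
  apply: le_trans (_ : \sum_(v <- words k n) x ^+ n * nu n v <= _).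
    apply: ler_sum => v _; rewrite /c; case: ltP => [/ltW|_]; rewrite ?mul1r//.
    by rewrite mul0r mulr_ge0// exprn_ge0// ltW.
  by rewrite -mulr_sumr ler_piMr// exprn_ge0// ltW.
have F_null : mu (lim_sup_set F) = 0%E.
  apply: lim_sup_set_cvg0 => //.
  apply: (@le_lt_trans _ _ (\sum_(0 <= n <oo) (x ^+ n)%:E)%E).
    apply: lee_nneseries => n _; first by rewrite measure_ge0.
    by have := prF n; rewrite -lee_fin prE.
  apply: (@le_lt_trans _ _ ((1 - x)^-1)%:E); last by rewrite ltry.
  apply: lime_le; first by apply: is_cvg_nneseries => n _; rewrite lee_fin exprn_ge0// ltW.
  near=> n; rewrite sumEFin lee_fin big_mkord -[leRHS]mul1r.
  rewrite ler_pdivlMr ?subr_gt0// mulrC -opprB mulNr -subrX1 opprB gerBl.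
  by rewrite exprn_ge0// ltW.
pose EV := [set w | exists N, forall n, (N <= n)%N -> expR (- r) ^+ n <= p n w].
have mEV : measurable EV.
  rewrite (_ : EV = \bigcup_N \bigcap_(n in [set n | (N <= n)%N])
      ~` [set w | p n w < expR (- r) ^+ n]).
    apply: bigcupT_measurable => N; apply: bigcap_measurableType => n _.
    apply: measurableC; under eq_set do rewrite ball_same_letter.
    exact: (measurable_itinerary n
      (fun v => pr (cylinder S a v) < expR (- r) ^+ n)).
  apply/seteqP; split => [w [N h]|w [N _ h]]; exists N => // n nN.
    by apply/negP; rewrite -leNgt; exact: h.
  by rewrite leNgt; apply/negP; exact: h.
apply: (ae_pr1 mEV); apply/eqP; rewrite eq_le pr_le1//= leNgt; apply/negP => lt.
(* The bad set is chosen small relative to the supposed exceptional set, so that the points with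
   large averages have measure below [1 - pr EV]. *)
have lt' : 0 < (1 - pr EV) * t by rewrite mulr_gt0// subr_gt0.
have [M] := bad_set_small mp m.+1 full lt'.
set Bad := bad_set _ _ _ _ _ _ => hM.
have mBad : measurable Bad by exact: measurable_bad_set.
have mL := measurable_large_average mS t mBad.
have : pr (large_average S Bad t) < 1 - pr EV.
  by rewrite (le_lt_trans (pr_maximal mS muS mBad t0))// ltr_pdivrMr.
rewrite ltNge => /negP; apply; rewrite -prC//.
have mlim : measurable (lim_sup_set F).
  by apply: bigcapT_measurable => n; exact: bigcup_measurable.
suff sub : ~` EV `<=` lim_sup_set F `|` large_average S Bad t.
  rewrite (le_trans (le_pr mu _ _ sub))//; first exact: measurableC.
    exact: measurableU.
  by rewrite prU0.
move=> w nEV; apply: contrapT => /not_orP[nlim nlarge]; apply: nEV.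
have [N0 hN0] : exists N0, forall n, (N0 <= n)%N ->
    x ^+ n * nu n (itinerary S a n w) <= p n w.
  apply: contrapT => h; apply: nlim => N _.
  apply: contrapT => h'; apply: h; exists N => n Nn.
  by rewrite leNgt; apply/negP => hF; apply: h'; exists n.
exists (maxn N0 (Num.truncn (- ln E * M%:R / g)).+2) => n.
rewrite geq_max => /andP[nN0 nK].
apply: le_trans (hN0 n nN0).
have Kn : - ln E * M%:R <= g * n%:R.
  rewrite -ler_pdivrMl// mulrC (le_trans (ltW (truncnS_gt _)))//.
  by rewrite ler_nat ltnW.
have n0 : (0 < n)%N by rewrite (leq_trans _ nK).
have few : (orbit_sum S (fun v => v \in Bad) n w)%:R <= t * n%:R.
  by rewrite leNgt; apply/negP => /ltW hB; apply: nlarge; exists n.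
have costE : cost mu S (same_letter a) set0 (expR (- r')) m.+1 M =
    (fun v => v \in Bad) :> (T -> nat).
  by apply/funext => v; rewrite /cost in_set0.
have relU w' v : ~ set0 w' -> same_letter a w' v -> a v = a w' by [].
have := parse_itinerary mu mS ma mball relU M w x01 s01 (ltn0Sn m) (leqnn n).
rewrite costE -/theta -/(nu n _) -/E => h.
apply: le_trans (ler_wpM2l (exprn_ge0 n (ltW x0)) h).
have xn0 : 0 < x ^+ n by rewrite exprn_gt0.
have pos C : 0 < (x ^+ 2 * expR (- r')) ^+ n * E ^+ C.
  by rewrite (mulr_gt0 (exprn_gt0 _ (mulr_gt0 _ _)) (exprn_gt0 _ E0))//
    ?exprn_gt0 ?expR_gt0.
rewrite -ler_ln ?posrE ?(mulr_gt0 xn0)//; last by rewrite exprn_gt0// expR_gt0.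
rewrite lnM ?posrE//.
rewrite ln_parse_bound// !lnXn ?expR_gt0// !expRK natrD.
rewrite -[_ *+ n]mulr_natl -[- (g / 6) *+ n]mulr_natl.
have few' := ler_wpM2r l0 few.
have tln := ler_wpM2r (ler0n R n) tl.
rewrite gr; exact: exponent_bound Kn few' tln.
Unshelve. all: by end_near. Qed.

End letter.
End entropy_growth.

(** * Bowen balls and partitions of a metric space *)

Section borel.
Context {X Y : ptopologicalType}.

Lemma open_borel (A : set X) : open A -> measurable (A : set (borel X)).
Proof. by move=> oA; apply: sub_sigma_algebra. Qed.

Lemma continuous_borel (g : X -> Y) : continuous g ->
  measurable_fun [set: borel X] (g : borel X -> borel Y).
Proof.
move=> /continuousP cg.
apply: (@measurability _ _ (borel X) (borel Y) _ _ (@open Y)) => //.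
by move=> _ [B oB <-]; rewrite setTI; exact: open_borel (cg _ oB).
Qed.

End borel.

Section bowen_balls.
Context {R : realType} {X : pmetricType R} (f : X -> X).
Hypothesis cf : continuous f.

Lemma continuous_iter n : continuous (iter n f).
Proof.
elim: n => [|n IH] x /=; first exact: cvg_id.
by apply: continuous_comp; [exact: IH|exact: cf].
Qed.

Lemma open_nbhs_mem (A : set X) : (forall y, A y -> nbhs y A) -> open A.
Proof. by rewrite openE. Qed.

Lemma open_mdist_lt (x : X) (e : R) : open [set y | mdist x y < e].
Proof.
apply: open_nbhs_mem => y /= xy; apply/nbhs_ballP.
exists (e - mdist x y); first by rewrite /= subr_gt0.
by move=> z; rewrite ballEmdist/= => yz; rewrite (le_lt_trans (metric_triangle _ y _))// -ltrBrDl.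
Qed.

Lemma open_bowen_ball n y (e : R) : open (bowen_ball f n y e).
Proof.
have step m : bowen_ball f m.+1 y e = bowen_ball f m y e `&`
    iter m.+1 f @^-1` [set z | mdist (iter m.+1 f y) z < e].
  apply/seteqP; split => z.
    by move=> h; split => [i im|]; apply: h => //; exact: leqW.
  by move=> [h1 h2] i; rewrite leq_eqVlt => /predU1P[->//|]; exact: h1.
have base : bowen_ball f 0 y e = [set z | mdist y z < e].
  apply/seteqP; split => z h; first exact: (h 0%N).
  by move=> i; rewrite leqn0 => /eqP ->.
elim: n => [|n IH]; first by rewrite base; exact: open_mdist_lt.
rewrite step; apply: openI => //.
by apply: open_comp => [z _|]; [exact: continuous_iter|exact: open_mdist_lt].
Qed.

Lemma measurable_bowen_ball n y (e : R) :
  measurable (bowen_ball f n y e : set (borel X)).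
Proof. by apply: open_borel; exact: open_bowen_ball. Qed.

Lemma subset_bowen_ball n y (e e' : R) : e <= e' ->
  bowen_ball f n y e `<=` bowen_ball f n y e'.
Proof. by move=> ee' z h i /h /lt_le_trans; apply. Qed.

(** Lower semicontinuity in the centre, needed for measurability. A slightly smaller radius still
    gives measure above [t], and that smaller ball stays inside the ball about any centre whose
    orbit is close enough. *)
Lemma open_pr_bowen_ball (mu : probability (borel X) R) n (e t : R) :
  open [set y | t < pr mu (bowen_ball f n y e)].
Proof.
apply: open_nbhs_mem => y /= ty.
pose F (j : nat) : set (borel X) := bowen_ball f n y (e - j.+1%:R^-1).
have mF j : measurable (F j) by exact: measurable_bowen_ball.
have FE : bowen_ball f n y e = \bigcup_j F j.
  apply/seteqP; split => z; last first.
    by move=> [j _]; apply: subset_bowen_ball; rewrite gerBl.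
  move=> h.
  (* Finitely many strict inequalities leave a common gap, given by the largest [J i]. *)
  have /choice[J hJ] : forall i, exists j : nat, (i <= n)%N ->
      mdist (iter i f y) (iter i f z) < e - j.+1%:R^-1.
    move=> i; have [ilen|] := boolP (i <= n)%N; last by exists 0%N.
    have d0 : 0 < e - mdist (iter i f y) (iter i f z) by rewrite subr_gt0 h.
    exists (Num.truncn (e - mdist (iter i f y) (iter i f z))^-1) => _.
    by rewrite ltrBrDl addrC -ltrBrDl invf_plt ?posrE// truncnS_gt.
  exists (\max_(i < n.+1) J i)%N => // i ilen; apply: lt_le_trans (hJ i ilen) _.
  rewrite lerD2l lerN2 lef_pV2 ?posrE// ler_nat ltnS.
  by apply: (@leq_bigmax _ (fun i : 'I_n.+1 => J i) (Ordinal (ilen : (i < n.+1)%N))).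
have ndF i j : (i <= j)%N -> F i `<=` F j.
  move=> ij; apply: subset_bowen_ball; rewrite lerD2l lerN2 lef_pV2 ?posrE//.
  by rewrite ler_nat.
have : mu (F j) @[j --> \oo] --> mu (\bigcup_j F j).
  apply: nondecreasing_cvg_mu => //; first exact: bigcupT_measurable.
  by move=> i j ij; apply/subsetPset; exact: ndF.
rewrite -FE -(prE mu (measurable_bowen_ball _ _ _)) => /fine_cvgP[_].
move=> /cvgr_gt/(_ t ty)[j _ /(_ j (leqnn j)) /= hj].
apply: (@filterS _ _ _ (bowen_ball f n y j.+1%:R^-1)); last first.
  apply: open_nbhs_nbhs; split; first exact: open_bowen_ball.
  by move=> i _; rewrite mdistxx.
move=> y' yy' /=; apply: lt_le_trans hj _.
apply: le_pr; [exact: mF|exact: measurable_bowen_ball|] => z h i ilen.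
rewrite (le_lt_trans (metric_triangle _ (iter i f y) _))//.
rewrite (metric_sym (iter i f y')).
rewrite -[e in ltRHS](subrKC j.+1%:R^-1) ltrD//; first exact: yy'.
exact: h.
Qed.

End bowen_balls.

(** * Approximation of measurable sets up to small perturbations of points *)

Section approximation.
Context {R : realType} {X : pmetricType R} (mu : probability (borel X) R).

(** Membership in [A] is read off, outside a set of small measure, from any
    nearby point. The sets with this property form a sigma-algebra containing the
    open sets, so that no partition with boundary of measure zero is needed. *)
Definition robust (A : set X) : Prop := forall eta : R, 0 < eta ->
  exists (e : R) (B U : set (borel X)), [/\ 0 < e,
    measurable B /\ measurable U, pr mu U <= eta &
    forall y z, ~ U y -> mdist y z < e -> B z <-> A y].

(** The part of [A] near its complement shrinks to the empty set and serves as [U]; the complement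
    of a thinner neighbourhood serves as [B]. *)
Lemma robust_open A : open A -> robust A.
Proof.
move=> oA eta eta0.
pose N (j : nat) : set X := \bigcup_(y in ~` A) [set z | mdist y z < j.+1%:R^-1].
have oN j : open (N j) by apply: bigcup_open => y _; exact: open_mdist_lt.
have mN j : measurable (N j : set (borel X)) by exact: open_borel.
have mA : measurable (A : set (borel X)) by exact: open_borel.
have NA : \bigcap_j (N j `&` A) = set0.
  rewrite -subset0 => y /= h; have [_ Ay] := h 0%N I.
  have : nbhs y A by move: oA; rewrite openE => /(_ _ Ay).
  move=> /nbhs_ballP[e /= e0 eA].
  have [[z nAz zy] _] := h (Num.truncn e^-1) I.
  apply: nAz; apply: eA; rewrite ballEmdist/= metric_sym (lt_le_trans zy)//.
  by rewrite ltW// invf_plt ?posrE// truncnS_gt.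
have mNA j : measurable (N j `&` A : set (borel X)) by exact: measurableI.
have [||j hj] := @pr_nonincreasing_lt _ _ _ mu (fun j => N j `&` A) eta mNA.
- move=> i j ij z [[y nAy yz] Az]; split => //; exists y => //=.
  by rewrite (lt_le_trans yz)// lef_pV2 ?posrE// ler_nat.
- by rewrite NA /pr measure0.
(* Twice this radius is below [1 / (j + 1)]: if [z] is within [e] of both [y] and the complement,
   then [y] lies in [N j]. *)
pose e : R := (j.+1 * 2).+1%:R^-1.
have e0 : 0 < e by rewrite invr_gt0.
exists e, (~` N (j.+1 * 2)%N), (N j `&` A); split => //.
- by split => //; exact: measurableC.
- exact: ltW.
move=> y z nU yz; split => [nNz|Ay].
  apply: contrapT => nAy; apply: nNz; exists y => //.
move=> [x nAx xz]; apply: nU; split => //; exists x => //=.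
rewrite (le_lt_trans (metric_triangle _ z _))// (metric_sym z).
apply: lt_le_trans (ltrD xz yz) _.
rewrite -/e -mulr2n -[e *+ 2]mulr_natr /e ler_pdivrMl// ler_pdivlMr//.
by rewrite -natrM ler_nat mulnC.
Qed.

Lemma robust_measurable A : measurable (A : set (borel X)) -> robust A.
Proof.
suff : <<s @open X >> `<=` [set A | measurable (A : set (borel X)) /\ robust A].
  by move=> h mA; have [] := h _ mA.
apply: smallest_sub; last first.
  by move=> B oB; split; [exact: open_borel|exact: robust_open].
split.
- by split; [exact: measurable0|exact/robust_open/open0].
- move=> B [mB rB]; rewrite setTD; split; first exact: measurableC.
  move=> eta /rB[e [C [U [e0 [mC mU] hU h]]]].
  exists e, (~` C), U; split => //; first by split => //; exact: measurableC.
  by move=> y z nU yz /=; rewrite (h y z nU yz).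
- move=> F hF; have mF i : measurable (F i : set (borel X)) by have [] := hF i.
  split; first exact: bigcupT_measurable.
  move=> eta eta0.
  (* The tail of the union has small measure, so only finitely many [F i] have to be
     approximated. *)
  pose G n : set (borel X) := \bigcup_i F i `\` \bigcup_(i < n) F i.
  have mG n : measurable (G n).
    apply: measurableD; first exact: bigcupT_measurable.
    exact: bigcup_measurable.
  have G0 : \bigcap_n G n = set0.
    rewrite -subset0 => y h; have [[i _ Fi] _] := h 0%N I.
    by have [_] := h i.+1 I; apply; exists i => /=.
  have [||n hn] := @pr_nonincreasing_lt _ _ _ mu G (eta / 2) mG.
  + move=> i j ij z [Fz nF]; split => // -[l /= li Fl]; apply: nF.
    by exists l => //=; exact: leq_trans ij.
  + by rewrite G0 /pr measure0 divr_gt0.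
  have [e [B [U [e0 [mB mU] hU h]]]] : exists (e : R) (B U : set (borel X)),
    [/\ 0 < e, measurable B /\ measurable U, pr mu U <= eta / 2 &
    forall y z, ~ U y -> mdist y z < e -> B z <-> (\bigcup_(i < n) F i) y].
    have : 0 < eta / 2 by rewrite divr_gt0.
    elim: n {hn} (eta / 2) => [|n IH] t t0.
      exists 1, set0, set0; split => //.
        by rewrite /pr measure0 ltW.
      by move=> y z _ _; split => [|[]].
    have [|e1 [B1 [U1 [e10 [mB1 mU1] hU1 h1]]]] := IH (t / 2).
      by rewrite divr_gt0.
    have [|e2 [B2 [U2 [e20 [mB2 mU2] hU2 h2]]]] := (hF n).2 (t / 2).
      by rewrite divr_gt0.
    exists (Num.min e1 e2), (B1 `|` B2), (U1 `|` U2); split.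
    - by rewrite lt_min e10.
    - by split; exact: measurableU.
    - by rewrite (splitr t) (le_trans _ (lerD hU1 hU2))// prU.
    - move=> y z /not_orP[nU1 nU2]; rewrite lt_min => /andP[y1 y2].
      rewrite bigcup_mkord big_ord_recr -bigcup_mkord; split => -[] H;
        [left|right|left|right].
      + exact/(h1 y z).
      + exact/(h2 y z).
      + exact/(h1 y z).
      + exact/(h2 y z).
  exists e, B, (U `|` G n); split => //.
  + by split => //; exact: measurableU.
  + rewrite (splitr eta) (le_trans _ (lerD hU (ltW hn)))//.
    exact: prU.
  + move=> y z /not_orP[nU nG] yz; rewrite (h y z nU yz); split.
      by move=> [i _ Fi]; exists i.
    by move=> Fy; apply: contrapT => nF; apply: nG; split.
Qed.

End approximation.

(** * Partitions as letter functions *)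

Section letters.
Context {d : measure_display} {T : measurableType d} {k : nat}.

(** Meant for approximate cells [B i], which may overlap or fail to cover: some index is picked,
    with [i0] as default. *)
Definition pick_letter (i0 : 'I_k) (B : 'I_k -> set T) (z : T) : 'I_k :=
  odflt i0 [pick i | z \in B i].

Lemma measurable_pick_letter i0 B : (forall i, measurable (B i)) ->
  measurable_letter (pick_letter i0 B).
Proof.
move=> mB i.
pose g z := [ffun j : 'I_k => z \in B j].
pose D := [set h : {ffun 'I_k -> bool} | odflt i0 [pick j | h j] = i].
rewrite (_ : _ @^-1` _ = \bigcup_(h in D) \bigcap_(j in [set: 'I_k])
    (if h j then B j else ~` B j)).
  apply: fin_bigcup_measurable => // h _.
  apply: fin_bigcap_measurable => // j _.
  by case: (h j) => //; exact: measurableC.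
have gE z : pick_letter i0 B z = odflt i0 [pick j | g z j].
  by rewrite /pick_letter; congr odflt; apply: eq_pick => j; rewrite ffunE.
apply/seteqP; split => z /=.
  rewrite gE => gi; exists (g z) => // j _; rewrite ffunE.
  by case: ifPn => [|/negP]; rewrite inE.
move=> [h hi hz]; rewrite gE -hi; congr odflt; apply: eq_pick => j.
have := hz j I; rewrite ffunE; case: (h j) => [/mem_set//|].
by move=> nB; apply/negbTE; rewrite notin_setE.
Qed.

Lemma pick_letterP i0 B z : (exists i, B i z) -> B (pick_letter i0 B z) z.
Proof.
move=> [i Bi]; rewrite /pick_letter; case: pickP => [j|/(_ i)]; first by rewrite inE.
by rewrite mem_set.
Qed.

Lemma partition_letter (P : 'I_k -> set T) : measurable_partition P ->
  exists2 a : T -> 'I_k, measurable_letter a & forall i, P i = a @^-1` [set i].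
Proof.
move=> [mP tP cP].
have /choice[a ha] : forall z, exists i, P i z.
  by move=> z; have : [set: T] z by []; rewrite -cP => -[i _]; exists i.
have PE i : P i = a @^-1` [set i].
  apply/seteqP; split => z /=; last by move=> <-.
  by move=> Pz; apply: (tP _ _ I I); exists z; split.
by exists a => // i; rewrite -PE.
Qed.

Lemma letter_partition (a : T -> 'I_k) : measurable_letter a ->
  measurable_partition (fun i => a @^-1` [set i]).
Proof.
move=> ma; split => //; first by move=> i j _ _ [z [/= <- <-]].
by apply/seteqP; split => // z _; exists (a z).
Qed.

End letters.

Section metric_partitions.
Context {R : realType} {X : pmetricType R}.

(** Each cell is approximated with error [eta / k]. Off the union of the exceptional sets, [z] lies
    in exactly one approximate cell, the one with index [a y]. *)
Lemma robust_letter (mu : probability (borel X) R) (k : nat)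
    (a : borel X -> 'I_k) (eta : R) : measurable_letter a -> 0 < eta ->
  exists (e : R) (b : borel X -> 'I_k) (U : set (borel X)), [/\ 0 < e,
    measurable_letter b /\ measurable U, pr mu U <= eta &
    forall y z, ~ U y -> mdist (y : X) z < e -> b z = a y].
Proof.
move=> ma eta0.
have rob i := @robust_measurable R X mu _ (ma i).
have k0 : 0 < k%:R :> R by rewrite ltr0n (letter_gt0 a).
have /choice[t ht] : forall i, exists t : R * (set (borel X) * set (borel X)),
    [/\ 0 < t.1, measurable t.2.1 /\ measurable t.2.2, pr mu t.2.2 <= eta / k%:R &
    forall y z, ~ t.2.2 y -> mdist y z < t.1 -> t.2.1 z <-> a y = i].
  move=> i; have [|e [B [U h]]] := rob i (eta / k%:R); first by rewrite divr_gt0.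
  by exists (e, (B, U)).
pose U : set (borel X) := \big[setU/set0]_(i < k) (t i).2.2.
exists (\big[Num.min/1]_(i < k) (t i).1), (pick_letter (a point) (fun i => (t i).2.1)), U.
split.
- by elim/big_ind : _ => // [x y x0 y0|i _]; [rewrite lt_min x0|have [] := ht i].
- split; first by apply: measurable_pick_letter => i; have [_ []] := ht i.
  by apply: bigsetU_measurable => i _; have [_ []] := ht i.
- have h (s : seq 'I_k) : measurable (\big[setU/set0]_(i <- s) (t i).2.2) /\
      pr mu (\big[setU/set0]_(i <- s) (t i).2.2) <= (size s)%:R * (eta / k%:R).
    elim: s => [|i s [mI hI]].
      by rewrite big_nil /pr measure0 mul0r; split => //; exact: measurable0.
    have [_ [_ mU] hU _] := ht i.
    rewrite big_cons; split; first exact: measurableU.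
    by rewrite (le_trans (prU _ _ _))//= -natr1 mulrDl mul1r addrC lerD.
  have sz : size (index_enum 'I_k) = k.
    by rewrite [index_enum _]unlock -enumT size_enum_ord.
  have [_] := h (index_enum 'I_k).
  by rewrite sz mulrCA divff ?mulr1// gt_eqF.
- move=> y z nU yz.
  have hB i : (t i).2.1 z <-> a y = i.
    have [_ _ _] := ht i; apply.
      by move=> Uy; apply: nU; rewrite /U (bigD1 i)//=; left.
    by apply: lt_le_trans yz _; rewrite (bigD1 i)//= ge_min lexx.
  apply/esym/hB.
  apply: (@pick_letterP _ _ _ (a point) (fun i => (t i).2.1)).
  by exists (a y); exact/hB.
Qed.

(** Compactness gives finitely many balls of radius [e / 2] that cover; a point is labelled by one
    containing it. *)
Lemma small_partition (e : R) : compact [set: X] -> 0 < e ->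
  exists (k : nat) (a : borel X -> 'I_k), measurable_letter a /\
    forall y z, a y = a z -> mdist (y : X) z < e.
Proof.
move=> cX e0.
have := cX; rewrite compact_cover => /(_ X setT (fun x => [set y | mdist x y < e / 2])).
case.
- by move=> x _; exact: open_mdist_lt.
- by move=> x _; exists x => //=; rewrite mdistxx divr_gt0.
move=> D _ cov; pose s := finmap.enum_fset D.
have hs z : exists i : 'I_(size s), mdist (nth point s i) z < e / 2.
  have [x /= xD xz] := cov z I.
  have xs : (index x s < size s)%N by rewrite index_mem.
  by exists (Ordinal xs); rewrite /= nth_index.
have [i0 _] := hs point.
pose B (i : 'I_(size s)) : set (borel X) := [set z | mdist (nth point s i) z < e / 2].
exists (size s), (pick_letter i0 B); split.
  apply: measurable_pick_letter => i; apply: open_borel; exact: open_mdist_lt.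
move=> y z yz.
have := @pick_letterP _ _ _ i0 B y (hs y).
have := @pick_letterP _ _ _ i0 B z (hs z).
rewrite yz /B/= => hz hy.
rewrite (le_lt_trans (metric_triangle _ (nth point s (pick_letter i0 B z)) _))//.
by rewrite metric_sym [e]splitr ltrD.
Qed.

End metric_partitions.

(** * The natural extension *)

Section natural_extension.
Context {R : realType} {X : pmetricType R} {f : X -> X}.
Context (cX : compact [set: X]) (cf : continuous f).
Local Notation Xhat := (inverse_limit cX cf).
Local Notation coord := (@inverse_limit_coord R X f cX cf).

Let backward_seqP (xh : Xhat) :
  backward_orbits f (fun i => coord xh i.+1).
Proof. by move=> i; exact: (set_valP xh i.+1). Qed.

Definition backward_shift (xh : Xhat) : Xhat :=
  exist _ (fun i => coord xh i.+1) (mem_set (backward_seqP xh)).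

Lemma coord_succ xh i : f (coord xh i.+1) = coord xh i.
Proof. exact: (set_valP xh i). Qed.

Lemma coord_backward_shift n xh i :
  coord (iter n backward_shift xh) i = coord xh (i + n).
Proof.
elim: n i => [|n IH] i; first by rewrite addn0.
by rewrite iterS [LHS](IH i.+1) addSnnS.
Qed.

Lemma iter_coord n i xh : (i <= n)%N -> iter i f (coord xh n) = coord xh (n - i).
Proof.
elim: i => [|i IH] ilen; first by rewrite subn0.
by rewrite iterS IH 1?ltnW// -[(n - i)%N]prednK ?subn_gt0// coord_succ subnS.
Qed.

Lemma inverse_limit_shiftK :
  cancel (@inverse_limit_shift R X f cX cf) backward_shift.
Proof. by move=> xh; apply: val_inj. Qed.

Lemma continuous_coord i : continuous (fun xh : Xhat => coord xh i).
Proof.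
move=> xh; apply: (@continuous_comp _ _ _ (set_val : Xhat -> prod_topology (fun _ : nat => X))
  (fun x : prod_topology (fun _ : nat => X) => x i)).
  exact: initial_continuous.
exact: (@proj_continuous nat (fun _ => X) i).
Qed.

Lemma continuous_backward_shift : continuous backward_shift.
Proof.
apply: (@continuous_comp_initial _ Xhat _ (set_val : _ -> prod_topology (fun _ : nat => X))).
move=> xh; apply/cvg_sup; first exact/fmap_filter/(nbhs_filter (xh : Xhat)).
move=> i.
have ci : continuous (set_val \o backward_shift :
    Xhat -> initial_topology (fun x : nat -> X => x i)).
  apply: (@continuous_comp_initial (nat -> X) Xhat X (fun x : nat -> X => x i)).
  exact: (@continuous_coord i.+1).
exact: ci.
Qed.

End natural_extension.

(** * Words as labels of join cells *)

Section itinerary_words.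
Context {T : Type} (S : T -> T) (k : nat).

Lemma itinerary_enum (a : T -> 'I_k) n w :
  itinerary S a n w = [seq a (iter (i : 'I_n) S w) | i <- enum 'I_n].
Proof.
have -> : [seq a (iter (i : 'I_n) S w) | i <- enum 'I_n] =
    [seq a (iter i S w) | i <- iota 0 n] by rewrite -val_enum_ord -map_comp.
elim: n w => //= n IH w; congr cons; rewrite IH (iotaDl 1 0) -map_comp.
by apply: eq_map => i /=; rewrite -iterSr.
Qed.

(** The reversal translates between the two directions of time: [x_(-i)] is reached from
    [x_(-(n-1))] at forward time [n - 1 - i]. *)
Definition word_of (n : nat) (w : {ffun 'I_n -> 'I_k}) : seq 'I_k :=
  [seq w (rev_ord i) | i <- enum 'I_n].

Lemma word_of_inj n : injective (@word_of n).
Proof.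
move=> v w /eq_in_map vw; apply/ffunP => i.
by rewrite -[i]rev_ordK; apply: vw; rewrite mem_enum.
Qed.

Lemma size_words n : size (words k n) = (k ^ n)%N.
Proof.
by elim: n => //= n IH; rewrite size_allpairs size_enum_ord IH expnS.
Qed.

(** [word_of] is an injection between sets of the same size [k ^ n], hence a bijection. *)
Lemma sum_words_ffun {R : realType} n (F : seq 'I_k -> R) :
  \sum_(v <- words k n) F v = \sum_(w : {ffun 'I_n -> 'I_k}) F (word_of w).
Proof.
rewrite -[RHS](big_map (@word_of n) xpredT F); apply: perm_big.
have uw : uniq [seq word_of w | w <- index_enum {ffun 'I_n -> 'I_k}].
  by rewrite map_inj_uniq ?index_enum_uniq//; exact: word_of_inj.
have sub : {subset [seq word_of w | w <- index_enum {ffun 'I_n -> 'I_k}] <=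
    words k n}.
  by move=> _ /mapP[w _ ->]; rewrite mem_words size_map size_enum_ord.
have [|_ e] := uniq_min_size uw sub.
  rewrite size_words size_map [index_enum _]unlock -enumT -cardT card_ffun.
  by rewrite !card_ord.
by rewrite perm_sym uniq_perm ?uniq_words.
Qed.

End itinerary_words.

(** * Backward orbits as itineraries of the inverse shift *)

Section natural_extension_measure.
Context {R : realType} {X : pmetricType R} {f : X -> X}.
Context (cX : compact [set: X]) (cf : continuous f).
Local Notation Xhat := (inverse_limit cX cf).
Local Notation coord := (@inverse_limit_coord R X f cX cf).
Variables (mu : probability (borel X) R) (muh : probability (borel Xhat) R).
Hypotheses
  (muh_inv : invariant_measure muh (@inverse_limit_shift R X f cX cf))
  (muh_erg : ergodic_measure muh (@inverse_limit_shift R X f cX cf))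
  (muh_proj : forall A : set X, (measurable : set (set (borel X))) A ->
    pushforward muh (@inverse_limit_proj R X f cX cf
      : borel (inverse_limit cX cf) -> borel X) A = mu A).

Local Notation S := (backward_shift (cX := cX) (cf := cf) : borel Xhat -> borel Xhat).

Lemma measurable_backward_shift : measurable_fun [set: borel Xhat] S.
Proof. exact: (continuous_borel (@continuous_backward_shift R X f cX cf)). Qed.

Lemma preimage_backward_shiftK (A : set (borel Xhat)) :
  @inverse_limit_shift R X f cX cf @^-1` (S @^-1` A) = A.
Proof.
by apply/seteqP; split => xh /=; rewrite inverse_limit_shiftK.
Qed.

Lemma backward_shift_invariant : invariant_measure muh S.
Proof.
move=> A mA; rewrite -[in RHS](preimage_backward_shiftK A) muh_inv//.
exact: measurable_preimage measurable_backward_shift _ mA.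
Qed.

Lemma backward_shift_ergodic : ergodic_measure muh S.
Proof.
move=> A mA SA; apply: muh_erg => //.
by rewrite -[in LHS]SA preimage_backward_shiftK.
Qed.

Let mS := measurable_backward_shift.
Let muS := backward_shift_invariant.

Lemma measurable_coord n (A : set (borel X)) : measurable A ->
  measurable ((coord^~ n : borel Xhat -> borel X) @^-1` A).
Proof.
move=> mA; rewrite -[X in measurable X]setTI.
exact: (continuous_borel (@continuous_coord R X f cX cf n)).
Qed.

(** Coordinate [n] is coordinate 0 after [n] backward shifts, so invariance gives it the law [mu]
    too. *)
Lemma pr_coord n (A : set (borel X)) : measurable A ->
  pr muh ((coord^~ n : borel Xhat -> borel X) @^-1` A) = pr mu A.
Proof.
move=> mA.
have m0 := measurable_coord 0 mA.
rewrite (_ : _ @^-1` _ = iter n S @^-1` ((coord^~ 0%N : borel Xhat -> borel X) @^-1` A)).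
  by rewrite (pr_iter_preimage mS muS)// /pr -muh_proj.
by apply/seteqP; split => xh /=; rewrite coord_backward_shift.
Qed.

Definition coord_close (e : R) (xh yh : Xhat) : Prop :=
  mdist (coord xh 0) (coord yh 0) < e.

(** Reversal of time: [x_(-i)] is the image of [x_(-n)] at time [n - i]. The length is [n.+1]
    because [bowen_ball f n] imposes conditions at the times 0 to [n]. *)
Lemma ball_coord_close e n xh : ball_along S (coord_close e) n.+1 xh =
  (coord^~ n : borel Xhat -> borel X) @^-1` bowen_ball f n (coord xh n) e.
Proof.
have cE i yh : coord (iter i S yh) 0 = coord yh i by rewrite coord_backward_shift.
apply/seteqP; split => yh h i ilen.
  rewrite /= !iter_coord// -(cE _ xh) -(cE _ yh); apply: h.
  by rewrite ltnS leq_subr.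
rewrite /coord_close !cE -[i](subKn (ilen : (i <= n)%N)).
by have := h (n - i)%N (leq_subr _ _); rewrite !iter_coord// leq_subr.
Qed.

Lemma measurable_ball_coord_close e n xh :
  measurable (ball_along S (coord_close e) n xh).
Proof.
case: n => [|n]; first by rewrite (_ : ball_along _ _ _ _ = setT)//; apply/seteqP.
rewrite ball_coord_close; apply: measurable_coord.
exact: measurable_bowen_ball.
Qed.

Lemma pr_ball_coord_close e n xh : pr muh (ball_along S (coord_close e) n.+1 xh) =
  pr mu (bowen_ball f n (coord xh n) e).
Proof.
by rewrite ball_coord_close pr_coord//; exact: measurable_bowen_ball.
Qed.

Lemma measurable_pr_ball_coord_close e n t :
  measurable [set xh | t < pr muh (ball_along S (coord_close e) n xh)].
Proof.
case: n => [|n].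
  have b0 xh : ball_along S (coord_close e) 0 xh = setT by apply/seteqP.
  under eq_set do rewrite b0.
  have [h|h] := pselect (t < pr muh setT).
    by rewrite (_ : [set _ | _] = setT)//; apply/seteqP; split.
  by rewrite (_ : [set _ | _] = set0)//; apply/seteqP; split.
under eq_set do rewrite pr_ball_coord_close.
apply: (@measurable_coord n [set y | t < pr mu (bowen_ball f n y e)]).
by apply: open_borel; exact: open_pr_bowen_ball.
Qed.

Section letter.
Variables (k : nat) (a : borel X -> 'I_k).
Hypothesis ma : measurable_letter a.
Local Notation P := (fun i => a @^-1` [set i]).
Let ah (xh : borel Xhat) : 'I_k := a (coord xh 0).

Lemma measurable_coord_letter : measurable_letter ah.
Proof. by move=> i; exact: (measurable_coord 0 (ma i)). Qed.

Lemma measurable_join_cell n (w : {ffun 'I_n -> 'I_k}) :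
  measurable (join_cell (f : borel X -> borel X) P w).
Proof.
apply: fin_bigcap_measurable => // i _.
apply: measurable_iter_preimage => //.
exact: continuous_borel.
Qed.

Lemma cylinder_word_of n (w : {ffun 'I_n -> 'I_k}) :
  cylinder S ah (word_of w) =
  (coord^~ n.-1 : borel Xhat -> borel X) @^-1` join_cell (f : borel X -> borel X) P w.
Proof.
have revE (i : 'I_n) : (n.-1 - i)%N = rev_ord i by rewrite /= -subn1 -subnDA add1n.
have hn (i : 'I_n) : (i <= n.-1)%N by rewrite -ltnS prednK// (leq_trans _ (ltn_ord i)).
rewrite /cylinder /word_of size_map size_enum_ord.
apply/seteqP; split => yh; rewrite /= itinerary_enum.
  move=> /eq_in_map h i _ /=; rewrite iter_coord// revE.
  have := h (rev_ord i) (mem_enum _ _); rewrite rev_ordK /ah.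
  by rewrite coord_backward_shift add0n.
move=> h; apply/eq_in_map => i _.
have : a (iter (rev_ord i) f (coord yh n.-1)) = w (rev_ord i) := h (rev_ord i) I.
by rewrite iter_coord// revE rev_ordK /ah coord_backward_shift add0n.
Qed.

Lemma word_entropy_join n : word_entropy muh S ah n = join_entropy mu f P n.
Proof.
rewrite /word_entropy /join_entropy sum_words_ffun; congr (- _).
apply: eq_bigr => w _; rewrite cylinder_word_of pr_coord//.
exact: measurable_join_cell.
Qed.

Lemma entropy_rate_partition :
  entropy_rate muh S ah = partition_entropy mu f P.
Proof.
rewrite /entropy_rate (_ : (fun n => word_entropy muh S ah n / n%:R) =
  (fun n => join_entropy mu f P n / n%:R))//.
by apply/funext => n; rewrite word_entropy_join.
Qed.

End letter.
End natural_extension_measure.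

(** * Local entropy *)

Section extended_limits.
Context {R : realType}.
Local Open Scope ereal_scope.

Lemma ereal_rat_between (x y : \bar R) : x < y ->
  exists2 q : rat, x < (ratr q)%:E & (ratr q)%:E < y.
Proof.
move: x y => [x| |] [y| |]//; rewrite ?lte_fin => xy.
- by have [q /[!in_itv]/andP[]] := rat_in_itvoo xy; exists q.
- have /rat_in_itvoo[q /[!in_itv]/andP[xq _]] : (x < x + 1)%R by rewrite ltrDl.
  by exists q; rewrite ?ltry.
- have /rat_in_itvoo[q /[!in_itv]/andP[_ qy]] : (y - 1 < y)%R by rewrite gtrBl.
  by exists q; rewrite ?ltNyr.
- by exists 0%R; rewrite ?ltNyr ?ltry.
Qed.

Lemma limn_esup_le (u : (\bar R)^nat) (c : \bar R) N :
  (forall n, (N <= n)%N -> u n <= c) -> limn_esup u <= c.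
Proof.
move=> h; rewrite /limn_esup limf_esupE.
apply: (@le_trans _ _ (ereal_sup (u @` [set n | (N <= n)%N]))).
  by apply: ereal_inf_lbound; exists [set n | (N <= n)%N] => //; exists N.
by apply: ge_ereal_sup => _ [n /= Nn <-]; exact: h.
Qed.

Lemma limn_einf_ge (u : (\bar R)^nat) (c : \bar R) N :
  (forall n, (N <= n)%N -> c <= u n) -> c <= limn_einf u.
Proof.
move=> h; rewrite /limn_einf leeNr; apply: (@limn_esup_le _ _ N) => n Nn.
by rewrite leeN2; exact: h.
Qed.

Local Notation rate b := (fun n : nat => - lne (b n)%:E / n%:R%:E).

(** Having [n.+1] instead of [n] in the exponent costs at most [|r| / n], which vanishes in the
    limit. *)
Lemma limn_esup_rate_le (b : nat -> R) (r : R) N :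
  (forall n, (N <= n)%N -> (expR (- r) ^+ n.+1 <= b n)%R) ->
  limn_esup (rate b) <= r%:E.
Proof.
move=> h; apply/lee_addgt0Pr => e e0.
apply: (@limn_esup_le _ _ (maxn N (Num.truncn (`|r| / e)%R).+1)) => n.
rewrite geq_max => /andP[Nn nK].
have n0 : (0 < n%:R :> R)%R by rewrite ltr0n (leq_trans _ nK).
have b0 : (0 < b n)%R by rewrite (lt_le_trans _ (h n Nn))// exprn_gt0// expR_gt0.
rewrite /lne (lt_geF b0) inver gt_eqF// -EFinN -EFinM -EFinD lee_fin.
rewrite ler_pdivrMr// lerNl.
have : (ln (expR (- r) ^+ n.+1) <= ln (b n))%R.
  by rewrite ler_ln ?posrE ?h// exprn_gt0// expR_gt0.
apply: le_trans; rewrite lnXn ?expR_gt0// expRK -[(_ *+ n.+1)%R]mulr_natl -natr1.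
have : (`|r| <= e * n%:R)%R.
  by rewrite mulrC -ler_pdivrMr// (le_trans (ltW (truncnS_gt _)))// ler_nat.
have := ler_norm r; lra.
Qed.

Lemma limn_einf_rate_ge (b : nat -> R) (r : R) N :
  (forall n, (N <= n)%N -> (b n <= expR (- r) ^+ n)%R) ->
  r%:E <= limn_einf (rate b).
Proof.
move=> h; apply: (@limn_einf_ge _ _ N.+1) => n Nn.
have n0 : (0 < n%:R :> R)%R by rewrite ltr0n (leq_trans _ Nn).
(* When [b n <= 0] the logarithm is [-oo] and the rate is [+oo]. *)
rewrite inver gt_eqF// /lne; case: ifPn => [_|].
  by rewrite /= gt0_mulye ?leey// lte_fin invr_gt0.
rewrite -ltNge => b0.
rewrite -EFinN -EFinM lee_fin ler_pdivlMr// lerNr.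
have : (ln (b n) <= ln (expR (- r) ^+ n))%R.
  by rewrite ler_ln ?posrE ?(h n (ltnW Nn))// exprn_gt0// expR_gt0.
by move=> /le_trans; apply; rewrite lnXn ?expR_gt0// expRK mulNrn mulr_natr.
Qed.

Lemma cvg_at_right0_from_below (g : R -> \bar R) (h : \bar R) : 0 <= h ->
  (forall e, (0 < e)%R -> 0 <= g e <= h) ->
  (forall t : R, (0 <= t)%R -> t%:E < h ->
    exists2 d, (0 < d)%R & forall e, (0 < e <= d)%R -> t%:E <= g e) ->
  g e @[e --> (0 : R)^'+] --> h.
Proof.
case: h => [h| |]// h0 gh gt.
- have fing : \forall e \near 0%R^'+, g e \is a fin_num.
    near=> e; have /gh/andP[g0 gle] : (0 < e)%R by near: e; exact: nbhs_right_gt.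
    by rewrite ge0_fin_numE// (le_lt_trans gle)// ltry.
  apply/fine_cvgP; split => //.
  apply/cvgrPdist_le => t t0.
  have [d d0 hd] : exists2 d, (0 < d)%R &
      forall e, (0 < e <= d)%R -> (h - t)%:E <= g e.
    have [ht|ht] := leP 0%R (h - t)%R.
      by apply: gt => //; rewrite lte_fin ltrBlDr ltrDl.
    exists 1%R => // e /andP[e0 _]; have /andP[g0 _] := gh e e0.
    by rewrite (le_trans _ g0)// lee_fin ltW.
  near=> e; have e0 : (0 < e)%R by near: e; exact: nbhs_right_gt.
  have /andP[g0 gle] := gh e e0.
  have fe : (fine (g e))%:E = g e.
    by rewrite fineK// ge0_fin_numE// (le_lt_trans gle)// ltry.
  have hg : (fine (g e) <= h)%R by rewrite -lee_fin fe.
  rewrite /= ger0_norm ?subr_ge0// lerBlDr -lerBlDl -lee_fin fe hd// e0/=.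
  by near: e; exact: nbhs_right_le.
- apply/cvgeyPge => t.
  have t0 : (0 <= Num.max t 0)%R by rewrite le_max lexx orbT.
  have [d d0 hd] := gt _ t0 (ltry _).
  near=> e; apply: le_trans (hd e _); first by rewrite lee_fin le_max lexx.
  apply/andP; split; first by near: e; exact: nbhs_right_gt.
  by near: e; exact: nbhs_right_le.
Unshelve. all: by end_near. Qed.

End extended_limits.

Section local_entropy.
Context {R : realType} {X : pmetricType R} {f : X -> X}.
Context (cX : compact [set: X]) (cf : continuous f).
Local Notation Xhat := (inverse_limit cX cf).
Local Notation coord := (@inverse_limit_coord R X f cX cf).
Variables (mu : probability (borel X) R) (muh : probability (borel Xhat) R).
Hypotheses
  (muh_inv : invariant_measure muh (@inverse_limit_shift R X f cX cf))
  (muh_erg : ergodic_measure muh (@inverse_limit_shift R X f cX cf))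
  (muh_proj : forall A : set X, (measurable : set (set (borel X))) A ->
    pushforward muh (@inverse_limit_proj R X f cX cf
      : borel (inverse_limit cX cf) -> borel X) A = mu A).
Local Notation S := (backward_shift (cX := cX) (cf := cf) : borel Xhat -> borel Xhat).

Let mS := @measurable_backward_shift R X f cX cf.
Let muS := backward_shift_invariant muh_inv.
Let ergS := backward_shift_ergodic muh_erg.

(** For a partition into sets of diameter at most [e], cylinders of length [n.+1] lie in Bowen
    balls, and the entropy rate of the partition is below [r]. *)
Lemma ae_bowen_ball_ge (e r : R) : 0 < e -> (entropy mu f < r%:E)%E ->
  {ae muh, forall xh : Xhat, exists N, forall n, (N <= n)%N ->
    expR (- r) ^+ n.+1 <= pr mu (bowen_ball f n (coord xh n) e)}.
Proof.
move=> e0 hr.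
have [k [a [ma ha]]] := small_partition cX e0.
pose ah (xh : borel Xhat) : 'I_k := a (coord xh 0).
have mah : measurable_letter ah by exact: measurable_coord_letter.
have rate_lt : entropy_rate muh S ah < r.
  rewrite (entropy_rate_partition muh_inv muh_proj ma) -lte_fin.
  apply: le_lt_trans hr; apply: ereal_sup_ubound.
  by exists k, (fun i => a @^-1` [set i]); split => //; exact: letter_partition.
have := ae_eventually_cylinder_ge mS muS mah ergS rate_lt.
apply: filterS => xh [N hN]; exists N => n Nn.
apply: le_trans (hN n.+1 (leqW Nn)) _.
rewrite -(pr_ball_coord_close muh_inv muh_proj).
apply: le_pr; first exact: measurable_ball_same_letter.
  exact: measurable_ball_coord_close.
by move=> yh h i /h; rewrite /same_letter /ah /coord_close => /esym/ha.
Qed.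

(** A partition of entropy above [r] is made readable, off a set of small measure, from any point
    within [e]; the relation [coord_close] then satisfies the hypotheses of
    [pr_frequently_large_eq0]. *)
Lemma ae_bowen_ball_le (r : R) : 0 <= r -> (r%:E < entropy mu f)%E ->
  exists2 e : R, 0 < e & {ae muh, forall xh : Xhat, exists N, forall n, (N <= n)%N ->
    pr mu (bowen_ball f n (coord xh n) e) <= expR (- r) ^+ n}.
Proof.
move=> r0 /ereal_sup_gt[_ [k [P [mP ->]]]]; rewrite lte_fin => hr.
have [a ma Pa] := partition_letter mP.
have {}Pa : P = fun i => a @^-1` [set i] by apply/funext.
pose ah (xh : borel Xhat) : 'I_k := a (coord xh 0).
have mah : measurable_letter ah by exact: measurable_coord_letter.
move: hr; rewrite Pa -(entropy_rate_partition muh_inv muh_proj ma) -/ah => hr.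
(* A third of the gap, so that [r + 2 * t] stays strictly below the rate. *)
pose t := (entropy_rate muh S ah - r) / 3.
have t0 : 0 < t by rewrite divr_gt0 ?subr_gt0.
have [e [b [U [e0 [mb mU] hU hb]]]] := robust_letter mu ma (tolerance_gt0 ah t0).
pose bh (xh : borel Xhat) : 'I_k := b (coord xh 0).
have mbh : measurable_letter bh by exact: measurable_coord_letter.
pose Uh : set (borel Xhat) := (coord^~ 0%N : borel Xhat -> borel X) @^-1` U.
have mUh : measurable Uh by exact: measurable_coord.
have hUh : pr muh Uh <= tolerance k t.
  by rewrite /Uh (pr_coord muh_inv muh_proj).
have mball n xh : measurable (ball_along S (coord_close e) n xh).
  exact: measurable_ball_coord_close.
have mp n s : measurable [set xh | s < pr muh (ball_along S (coord_close e) n xh)].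
  exact: (measurable_pr_ball_coord_close muh_inv muh_proj).
have relU xh yh : ~ Uh xh -> coord_close e xh yh -> bh yh = ah xh.
  by move=> nU xy; exact: hb nU xy.
have lt : r + 2 * t < entropy_rate muh S ah by rewrite /t; lra.
have freq0 := pr_frequently_large_eq0 mS muS mah ergS mball mp mbh mUh relU r0 t0 hUh lt.
exists e => //.
have mF := measurable_frequently_large mp r.
have : {ae muh, forall xh, (~` frequently_large muh S (coord_close e) r) xh}.
  by apply: ae_pr1; [exact: measurableC|rewrite prC// freq0 subr0].
apply: filterS => xh nF.
apply: contrapT => h; apply: nF => m; apply: contrapT => h'; apply: h.
exists m => n mn; rewrite -(pr_ball_coord_close muh_inv muh_proj).
have : pr muh (ball_along S (coord_close e) n.+1 xh) <= expR (- r) ^+ n.+1.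
  by rewrite leNgt; apply/negP => hn; apply: h'; exists n.+1 => //; exact: leqW.
move=> /le_trans; apply; rewrite ler_wiXn2l ?expR_ge0//.
by rewrite -expR0 ler_expR oppr_le0.
Qed.

End local_entropy.

(** * Countable intersections and the limit in the radius *)

Local Open Scope ereal_scope.

Theorem lemma2p5 (R : realType) (X : pmetricType R) (f : X -> X)
    (cX : compact [set: X]) (cf : continuous f)
    (mu : probability (borel X) R)
    (mu_inv : invariant_measure mu f) (mu_erg : ergodic_measure mu f)
    (muh : probability (borel (inverse_limit cX cf)) R)
    (muh_inv : invariant_measure muh (@inverse_limit_shift R X f cX cf))
    (muh_erg : ergodic_measure muh (@inverse_limit_shift R X f cX cf))
    (muh_proj : forall A : set X, (measurable : set (set (borel X))) A ->
      pushforward muh (@inverse_limit_proj R X f cX cf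
        : borel (inverse_limit cX cf) -> borel X) A = mu A) :
  {ae muh, forall xh : inverse_limit cX cf,
    (limn_einf (fun n : nat =>
        - lne (mu (bowen_ball f n (inverse_limit_coord xh n) e)) / n%:R%:E)
      @[e --> (0 : R)%R^'+] --> entropy mu f) /\
    (limn_esup (fun n : nat =>
        - lne (mu (bowen_ball f n (inverse_limit_coord xh n) e)) / n%:R%:E)
      @[e --> (0 : R)%R^'+] --> entropy mu f)}.
Proof.
have FF : Filter (nbhs (almost_everywhere muh)).
  exact: ae_filter_ringOfSetsType.
pose b (xh : inverse_limit cX cf) (e : R) n : R :=
  pr mu (bowen_ball f n (inverse_limit_coord xh n) e).
have bE xh e n : mu (bowen_ball f n (inverse_limit_coord xh n) e) = (b xh e n)%:E.
  by rewrite prE//; exact: measurable_bowen_ball.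
have b_mono xh e e' n : (e <= e')%R -> (b xh e n <= b xh e' n)%R.
  move=> ee'; apply: le_pr; [exact: measurable_bowen_ball..|].
  exact: subset_bowen_ball.
(* Only radii [1 / (i + 1)] and rational rates, enumerated by [unpickle], are used, so that
   countably many almost sure statements are intersected. Monotonicity in the radius and density of
   the rationals recover the rest. *)
pose U (i j : nat) (xh : inverse_limit cX cf) :=
  forall q : rat, unpickle j = Some q -> entropy mu f < (ratr q)%:E ->
  exists N, forall n, (N <= n)%N ->
    (expR (- ratr q) ^+ n.+1 <= b xh i.+1%:R^-1 n)%R.
pose L (j : nat) (xh : inverse_limit cX cf) :=
  forall q : rat, unpickle j = Some q -> (0 <= ratr q :> R)%R ->
  (ratr q)%:E < entropy mu f -> exists2 e : R, (0 < e)%R &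
  exists N, forall n, (N <= n)%N -> (b xh e n <= expR (- ratr q) ^+ n)%R.
have aeU : {ae muh, forall xh, forall i j, U i j xh}.
  apply: ae_foralln => i; apply: ae_foralln => j.
  case Ej : (unpickle j) => [q|]; last by apply: aeW => xh q; rewrite Ej.
  have [hq|hq] := pselect (entropy mu f < (ratr q)%:E); last first.
    by apply: aeW => xh q'; rewrite Ej => -[<-].
  have i0 : (0 < i.+1%:R^-1 :> R)%R by rewrite invr_gt0.
  have := ae_bowen_ball_ge muh_inv muh_erg muh_proj i0 hq.
  by apply: filterS => xh h q'; rewrite Ej => -[<-].
have aeL : {ae muh, forall xh, forall j, L j xh}.
  apply: ae_foralln => j.
  case Ej : (unpickle j) => [q|]; last by apply: aeW => xh q; rewrite Ej.
  have [q0|q0] := pselect (0 <= ratr q :> R)%R; last first.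
    by apply: aeW => xh q'; rewrite Ej => -[<-].
  have [hq|hq] := pselect ((ratr q)%:E < entropy mu f); last first.
    by apply: aeW => xh q'; rewrite Ej => -[<-].
  have [e e0] := ae_bowen_ball_le muh_inv muh_erg muh_proj q0 hq.
  apply: filterS => xh h q'.
  by rewrite Ej => -[<-] _ _; exists e.
have : {ae muh, forall xh, (forall i j, U i j xh) /\ (forall j, L j xh)}.
  by apply: filterS2 aeU aeL.
apply: filterS => xh [hU hL].
pose u e := fun n : nat => - lne (b xh e n)%:E / n%:R%:E.
have uE e : (fun n : nat => - lne (mu (bowen_ball f n (inverse_limit_coord xh n) e))
    / n%:R%:E) = u e by apply/funext => n; rewrite bE.
have inf_ge0 e : 0 <= limn_einf (u e).
  apply: (@limn_einf_rate_ge _ _ 0%R 0) => n _.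
  by rewrite oppr0 expR0 expr1n pr_le1//; exact: measurable_bowen_ball.
have sup_le e : (0 < e)%R -> limn_esup (u e) <= entropy mu f.
  move=> e0; rewrite leNgt; apply/negP => lt.
  have [q hq1 hq2] : exists2 q : rat, entropy mu f < (ratr q)%:E &
      (ratr q)%:E < limn_esup (u e) by exact: ereal_rat_between.
  have := hU (Num.truncn e^-1)%R (pickle q) q (pickleK q) hq1.
  move=> [N hN]; move: hq2; apply/negP; rewrite -leNgt.
  apply: (@limn_esup_rate_le _ _ _ N) => n Nn.
  apply: le_trans (hN n Nn) _; apply: b_mono.
  by rewrite ltW// invf_plt ?posrE// truncnS_gt.
have inf_ge (t : R) : (0 <= t)%R -> t%:E < entropy mu f ->
    exists2 d, (0 < d)%R & forall e, (0 < e <= d)%R -> t%:E <= limn_einf (u e).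
  move=> t0 ht.
  have [q tq hq] : exists2 q : rat, (t < ratr q)%R & (ratr q)%:E < entropy mu f.
    by have [q] := ereal_rat_between ht; exists q; rewrite -?lte_fin.
  have q0 : (0 <= ratr q :> R)%R by rewrite (le_trans t0)// ltW.
  have [d d0 [N hN]] := hL (pickle q) q (pickleK q) q0 hq.
  exists d => // e /andP[e0 ed].
  apply: (@le_trans _ _ (ratr q)%:E); first by rewrite lee_fin ltW.
  apply: (@limn_einf_rate_ge _ _ _ N) => n Nn.
  by rewrite (le_trans (b_mono _ _ _ _ ed))// hN.
have h0 : 0 <= entropy mu f.
  exact: le_trans (inf_ge0 1%R) (le_trans (limn_einf_sup _) (sup_le _ ltr01)).
split; apply: cvg_at_right0_from_below => //.
- move=> e e0; rewrite uE inf_ge0/=.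
  exact: le_trans (limn_einf_sup _) (sup_le _ e0).
- move=> t t0 ht; have [d d0 hd] := inf_ge t t0 ht.
  by exists d => // e /hd; rewrite uE.
- move=> e e0; rewrite uE sup_le// andbT.
  exact: le_trans (inf_ge0 e) (limn_einf_sup _).
- move=> t t0 ht; have [d d0 hd] := inf_ge t t0 ht.
  exists d => // e /hd; rewrite uE => h.
  exact: le_trans h (limn_einf_sup _).
Qed.
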